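(* Let $(\eta^{ij})$ be a constant symmetric nondegenerate $N\times N$ matrix with inverse $(\eta_{ij})$, let $K$ be a constant, and let $h^i(v)$, $1\le i\le N$, be smooth functions on a domain of coordinates $v=(v^1,\dots,v^N)$ that satisfy, for all values of the free indices, $$\frac{\partial^2 h^i}{\partial v^k \partial v^s}\, \eta^{sp}\, \frac{\partial^2 h^j}{\partial v^p \partial v^l} = \frac{\partial^2 h^j}{\partial v^k \partial v^s}\, \eta^{sp}\, \frac{\partial^2 h^i}{\partial v^p \partial v^l},$$ $$\left( \eta^{ir} \frac{\partial h^s}{\partial v^r} + \eta^{sr} \frac{\partial h^i}{\partial v^r} - K v^i v^s \right) \eta^{jp} \frac{\partial^2 h^k}{\partial v^p \partial v^s} = \left( \eta^{jr} \frac{\partial h^s}{\partial v^r} + \eta^{sr} \frac{\partial h^j}{\partial v^r} - K v^j v^s \right) \eta^{ip} \frac{\partial^2 h^k}{\partial v^p \partial v^s}.$$ Then the system of hydrodynamic type $$v^i_{t_1} = \left( h^i(v) + \eta^{is} \frac{\partial h^j}{\partial v^s} \eta_{jl} v^l - \frac{K}{2}\, \eta_{sk}\, v^i v^s v^k \right)_x, \qquad 1\le i\le N,$$ is bi-Hamiltonian with respect to the pair of compatible Hamiltonian operators $$P_2^{ij} = \eta^{ij} \frac{d}{dx},$$ $$P_1^{ij} = \left( \eta^{is} \frac{\partial h^j}{\partial v^s} + \eta^{js} \frac{\partial h^i}{\partial v^s} - K v^i v^j \right) \frac{d}{dx} + \left( \eta^{is} \frac{\partial^2 h^j}{\partial v^s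 \partial v^k} - K \delta^i_k v^j \right) v^k_x + K v^i_x \left( \frac{d}{dx}\right)^{-1} v^j_x ,$$ namely $$v^i_{t_1} = P_1^{ij} \frac{\delta H_1}{\delta v^j(x)} = P_2^{ij} \frac{\delta H_2}{\delta v^j(x)},$$ where $$H_1 = \frac12 \int \eta_{jl}\, v^j(x) v^l(x)\, dx, \qquad H_2 = \int \left( \eta_{jk}\, h^k(v(x))\, v^j(x) - \frac{K}{8}\, \eta_{jk}\eta_{sl}\, v^j v^k v^s v^l \right) dx .$$
   Context: Summation over repeated indices is understood; all indices run from $1$ to $N$. $v^i=v^i(x)$ are fields depending on $x$ (and time $t_1$), $v^i_x = dv^i/dx$, $\delta/\delta v^j(x)$ is the variational derivative. Considerations are formal: integrals of total $x$-derivatives vanish, and $(d/dx)^{-1}$ is the formal inverse of $d/dx$ with zero integration constant, e.g. $(d/dx)^{-1}\big(\eta_{jl} v^j_x v^l\big) = \tfrac12 \eta_{jl} v^j v^l$. An operator $P^{ij}$ is Hamiltonian if $\{I,J\} = \int \frac{\delta I}{\delta v^i(x)} P^{ij} \frac{\delta J}{\delta v^j(x)} dx$ is a Poisson bracket (skew-symmetric, satisfying the Jacobi identity). Two Hamiltonian operators are compatible if every linear combination of them with constant coefficients is Hamiltonian. It is a known fact that $P^{ij} = g^{ij}(v)\frac{d}{dx} + b^{ij}_k(v) v^k_x + K v^i_x (d/dx)^{-1} v^j_x$ ($K$ constant, $g^{ij}$ possibly degenerate) is Hamiltonian if and only if: (1) $g^{ij}=g^{ji}$; (2) $\partial g^{ij}/\partial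 v^k = b^{ij}_k + b^{ji}_k$; (3) $g^{is} b^{jr}_s = g^{js} b^{ir}_s$; (4) $g^{is}\left(\frac{\partial b^{jr}_s}{\partial v^k} - \frac{\partial b^{jr}_k}{\partial v^s}\right) + b^{ij}_s b^{sr}_k - b^{ir}_s b^{sj}_k = K(g^{ir}\delta^j_k - g^{ij}\delta^r_k)$; (5) $\sum_{(i,j,r)} \Big[ b^{si}_p \Big(\frac{\partial b^{jr}_k}{\partial v^s} - \frac{\partial b^{jr}_s}{\partial v^k}\Big) + K(b^{ij}_k - b^{ji}_k)\delta^r_p + b^{si}_k \Big(\frac{\partial b^{jr}_p}{\partial v^s} - \frac{\partial b^{jr}_s}{\partial v^p}\Big) + K(b^{ij}_p - b^{ji}_p)\delta^r_k \Big] = 0$, the sum being over cyclic permutations of $i,j,r$. *)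

(* Defs.v *)
From mathcomp Require Import all_boot all_order all_algebra.
From mathcomp Require Import all_classical all_reals all_analysis.
Set Implicit Arguments.
Unset Strict Implicit.
Unset Printing Implicit Defensive.
Import Order.TTheory GRing.Theory Num.Theory.
Import numFieldNormedType.Exports.
Local Open Scope classical_set_scope.
Local Open Scope ring_scope.

Definition domain (R : realType) (N : nat) (U : set 'rV[R]_N) : Prop :=
  [/\ open U, connected U & U !=set0].

(* C^oo on an open set A: every iterated directional derivative is (Frechet)
   differentiable at every point of A. *)
Definition smooth_on (R : realType) (V : normedModType R) (A : set V)
    (f : V -> R) : Prop :=
  forall (s : seq V) (x : V), A x ->
    differentiable (foldr (fun w (g : V -> R) => 'D_w g) f s) x.

Definition pd (R : realType) (N : nat) (s : 'I_N) (f : 'rV[R]_N -> R)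
  : 'rV[R]_N -> R := 'D_(delta_mx 0 s) f.

(* ------------------------------------------------------------------------- *)
(* Formal calculus of variations.  A jet u is the sequence of values of the  *)
(* fields and of all their x-derivatives at a point: u k 0 i stands for      *)
(* d^k v^i / dx^k.                                                           *)

Definition jet (R : realType) (N : nat) : Type := nat -> 'rV[R]_N.
Definition jfun (R : realType) (N : nat) : Type := jet R N -> R.

(* Jet functions are total, but only their values over U are meaningful. *)
Definition eq_over (R : realType) (N : nat) (U : set 'rV[R]_N)
    (f g : jfun R N) : Prop :=
  forall u : jet R N, U (u 0%N) -> f u = g u.

Definition trunc (R : realType) (N n : nat) (u : jet R N) : 'M[R]_(n.+1, N) :=
  \matrix_(k, i) u k 0 i.

(* Differential functions f(v, v_x, ..., v_(n)): smooth, of some finite order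
   n, with v ranging over U and v_x, ..., v_(n) unrestricted. *)
Definition diff_fun (R : realType) (N : nat) (U : set 'rV[R]_N)
    (f : jfun R N) : Prop :=
  exists (n : nat) (phi : 'M[R]_(n.+1, N) -> R),
    smooth_on [set A : 'M[R]_(n.+1, N) | U (row ord0 A)] phi /\
    eq_over U f (fun u => phi (trunc n u)).

(* Partial derivative with respect to the i-th component of d^k v / dx^k. *)
Definition jpd (R : realType) (N : nat) (k : nat) (i : 'I_N) (f : jfun R N)
  : jfun R N :=
  fun u => derive1 (fun t : R =>
    f (fun l => u l + (if l == k then t *: delta_mx 0 i else 0))) 0.

(* Total derivative d/dx.  For a differential function only finitely many
   terms are nonzero at a jet over U, so the finitely supported sum is the
   formal series. *)
Definition Dx (R : realType) (N : nat) (f : jfun R N) : jfun R N :=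
  fun u => \sum_(k \in [set: nat]) \sum_(i < N) u k.+1 0 i * jpd k i f u.

(* Variational derivative of the functional with density f (Euler operator):
   sum over k of (- d/dx)^k (df / dv^i_(k)). *)
Definition vard (R : realType) (N : nat) (f : jfun R N) (i : 'I_N) : jfun R N :=
  fun u => \sum_(k \in [set: nat]) (-1) ^+ k * iter k (@Dx R N) (jpd k i f) u.

(* Equality of the functionals with densities f and g: the integral is taken
   modulo total x-derivatives. *)
Definition eq_functional (R : realType) (N : nat) (U : set 'rV[R]_N)
    (f g : jfun R N) : Prop :=
  exists F : jfun R N, diff_fun U F /\ eq_over U (fun u => f u - g u) (Dx F).

(* Differential polynomials without constant term. *)
Inductive dpoly0 (R : realType) (N : nat) : jfun R N -> Prop :=
| dpoly0_coord (k : nat) (i : 'I_N) : dpoly0 (fun u => u k 0 i)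
| dpoly0_scale (c : R) (F : jfun R N) : dpoly0 F -> dpoly0 (fun u => c * F u)
| dpoly0_add (F G : jfun R N) :
    dpoly0 F -> dpoly0 G -> dpoly0 (fun u => F u + G u)
| dpoly0_mul (F G : jfun R N) :
    dpoly0 F -> dpoly0 G -> dpoly0 (fun u => F u * G u).

(* Dinv is a formal inverse of d/dx with zero integration constant: on a total
   derivative it returns an antiderivative, and it adds no constant to an
   antiderivative that is a differential polynomial without constant term.
   Two antiderivatives over a domain differ by a constant, hence the second
   clause is consistent; for other antiderivatives (such as functions of v that
   are not polynomial, when 0 is not in U) "zero constant" has no intrinsic
   meaning and the constant is left unspecified.  The values on jet functions
   that are not total derivatives are irrelevant. *)
Definition formal_inverse (R : realType) (N : nat) (U : set 'rV[R]_N)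
    (Dinv : jfun R N -> jfun R N) : Prop :=
  forall f F : jfun R N, diff_fun U F -> eq_over U f (Dx F) ->
    [/\ diff_fun U (Dinv f), eq_over U (Dx (Dinv f)) f
      & dpoly0 F -> eq_over U (Dinv f) F].

(* ------------------------------------------------------------------------- *)
(* An operator P^{ij} maps a covector xi_j to the vector P^{ij} xi_j.        *)

Definition operator (R : realType) (N : nat) : Type :=
  ('I_N -> jfun R N) -> ('I_N -> jfun R N).

Definition lin_comb (R : realType) (N : nat) (a b : R) (P Q : operator R N)
  : operator R N :=
  fun xi i u => a * P xi i u + b * Q xi i u.

(* Density of {I, J} for the functionals I and J with densities f and g. *)
Definition bracket (R : realType) (N : nat) (P : operator R N)
    (f g : jfun R N) : jfun R N :=
  fun u => \sum_(i < N) vard f i u * P (vard g) i u.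

(* The operation on densities induces a well-defined Poisson bracket on the
   space of local functionals. *)
Record poisson_bracket (R : realType) (N : nat) (U : set 'rV[R]_N)
    (B : jfun R N -> jfun R N -> jfun R N) : Prop := PoissonBracket {
  pb_closed : forall f g, diff_fun U f -> diff_fun U g -> diff_fun U (B f g);
  pb_welldef : forall f f' g g',
    diff_fun U f -> diff_fun U f' -> diff_fun U g -> diff_fun U g' ->
    eq_functional U f f' -> eq_functional U g g' ->
    eq_functional U (B f g) (B f' g');
  pb_linear : forall (a : R) f f' g,
    diff_fun U f -> diff_fun U f' -> diff_fun U g ->
    eq_functional U (B (fun u => a * f u + f' u) g)
                    (fun u => a * B f g u + B f' g u);
  pb_skew : forall f g, diff_fun U f -> diff_fun U g ->
    eq_functional U (B f g) (fun u => - B g f u);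
  pb_jacobi : forall f g h, diff_fun U f -> diff_fun U g -> diff_fun U h ->
    eq_functional U
      (fun u => B (B f g) h u + B (B g h) f u + B (B h f) g u)
      (fun=> 0)
}.

Definition hamiltonian (R : realType) (N : nat) (U : set 'rV[R]_N)
    (P : operator R N) : Prop := poisson_bracket U (bracket P).

Definition compatible (R : realType) (N : nat) (U : set 'rV[R]_N)
    (P Q : operator R N) : Prop :=
  forall a b : R, hamiltonian U (lin_comb a b P Q).

(* The system v^i_t = S i, i = 1, ..., N, is
   v^i_t = P^{ij} dH/dv^j(x) = Q^{ij} dG/dv^j(x), where H and G are the
   densities of the two Hamiltonians. *)
Definition bi_hamiltonian (R : realType) (N : nat) (U : set 'rV[R]_N)
    (S : 'I_N -> jfun R N) (P : operator R N) (H : jfun R N)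
    (Q : operator R N) (G : jfun R N) : Prop :=
  [/\ hamiltonian U P, hamiltonian U Q, compatible U P Q,
      diff_fun U H /\ diff_fun U G
    & forall i : 'I_N,
        eq_over U (S i) (P (vard H) i) /\ eq_over U (S i) (Q (vard G) i)].

(* ------------------------------------------------------------------------- *)
(* The operators, system and Hamiltonians attached to eta, K and h.  Here    *)
(* eta is (eta^{ij}) and invmx eta is (eta_{ij}).                            *)

(* eta^{is} dh^j/dv^s + eta^{js} dh^i/dv^s - K v^i v^j *)
Definition metric (R : realType) (N : nat) (eta : 'M[R]_N) (K : R)
    (h : 'I_N -> 'rV[R]_N -> R) (i j : 'I_N) (v : 'rV[R]_N) : R :=
  \sum_(s < N) eta i s * pd s (h j) v + \sum_(s < N) eta j s * pd s (h i) v
  - K * v 0 i * v 0 j.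

(* eta^{is} d^2h^j/dv^s dv^k - K delta^i_k v^j *)
Definition connection (R : realType) (N : nat) (eta : 'M[R]_N) (K : R)
    (h : 'I_N -> 'rV[R]_N -> R) (i j k : 'I_N) (v : 'rV[R]_N) : R :=
  \sum_(s < N) eta i s * pd s (pd k (h j)) v - K * (i == k)%:R * v 0 j.

(* The summation over j in the nonlocal term is performed inside (d/dx)^-1,
   where v^j_x dJ/dv^j(x) is a total derivative for every local functional J. *)
Definition P1 (R : realType) (N : nat) (Dinv : jfun R N -> jfun R N)
    (eta : 'M[R]_N) (K : R) (h : 'I_N -> 'rV[R]_N -> R) : operator R N :=
  fun xi i u =>
    \sum_(j < N) metric eta K h i j (u 0%N) * Dx (xi j) u
    + \sum_(j < N) \sum_(k < N)
        connection eta K h i j k (u 0%N) * u 1%N 0 k * xi j u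
    + K * u 1%N 0 i * Dinv (fun w => \sum_(j < N) w 1%N 0 j * xi j w) u.

Definition P2 (R : realType) (N : nat) (eta : 'M[R]_N) : operator R N :=
  fun xi i u => \sum_(j < N) eta i j * Dx (xi j) u.

Definition flow (R : realType) (N : nat) (eta : 'M[R]_N) (K : R)
    (h : 'I_N -> 'rV[R]_N -> R) (i : 'I_N) : jfun R N :=
  Dx (fun u : jet R N => let v := u 0%N in
    h i v
    + \sum_(s < N) \sum_(j < N) \sum_(l < N)
        eta i s * pd s (h j) v * invmx eta j l * v 0 l
    - K / 2 * \sum_(s < N) \sum_(k < N)
        invmx eta s k * v 0 i * v 0 s * v 0 k).

Definition H1 (R : realType) (N : nat) (eta : 'M[R]_N) : jfun R N :=
  fun u => let v := u 0%N in
    1 / 2 * \sum_(j < N) \sum_(l < N) invmx eta j l * v 0 j * v 0 l.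

Definition H2 (R : realType) (N : nat) (eta : 'M[R]_N) (K : R)
    (h : 'I_N -> 'rV[R]_N -> R) : jfun R N :=
  fun u => let v := u 0%N in
    \sum_(j < N) \sum_(k < N) invmx eta j k * h k v * v 0 j
    - K / 8 * \sum_(j < N) \sum_(k < N) \sum_(s < N) \sum_(l < N)
        invmx eta j k * invmx eta s l * v 0 j * v 0 k * v 0 s * v 0 l.

(* Main.v *)
From HB Require Import structures.
Require Import Defs.
From mathcomp Require Import all_boot all_order all_algebra.
From mathcomp Require Import all_classical all_reals all_analysis.
From mathcomp Require Import ring.
Set Implicit Arguments.
Unset Strict Implicit.
Unset Printing Implicit Defensive.
Import Order.TTheory GRing.Theory Num.Theory.
Import numFieldNormedType.Exports.
Local Open Scope classical_set_scope.
Local Open Scope ring_scope.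

(** Why the theorem holds.

    The combination a P1 + b P2 has the shape of P1 again, so that one
    computation serves the whole pencil.  Put
    B^{ij} = a eta^{is} dh^j/dv^s + (b/2) eta^{ij} and k = a K; the metric of
    the combination is g^{ij} = B^{ij} + B^{ji} - k v^i v^j.  For a covector x
    whose contraction v^j_x x_j is the total derivative of w, the function
    W = w - v^j x_j satisfies W_x = - v^j (x_j)_x, and the operator becomes
      (P x)^i = (B^{ij} x_j + k v^i W)_x + B^{ji} (x_j)_x,
    where the connection coefficients have disappeared and the nonlocality is
    confined to W ([ham_field], [operator_ham_field]).

    Integrating by parts once gives the bracket of two functionals with
    variational derivatives x and y a form that is skew up to a total derivative
    ([ham_field_pairing]).  For the Jacobi identity this form is differentiated
    along the evolutionary field Y of the third functional ([evol_bracket]).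
    The terms where Y acts on x or y cancel in the cyclic sum, because the
    linearization of a variational derivative is self-adjoint
    ([euler_self_adjoint]).  What remains is Y^s T_s, where T_s involves only
    dB/dv^s, x, y, x_x, y_x and the potentials W.  Its cyclic sum is zero
    identically, with no further integration by parts ([variation_cyclic]):
    the second condition on h says that g^{ls} dB^{ij}/dv^s is symmetric in i
    and l, the first one that (B^{sl})_x dB^{ij}/dv^s is symmetric in j and l.
    Both symmetries survive the addition of a multiple of eta to B because
    Hessians are symmetric.

    The identities are proved in an abstract [jet_algebra], a commutative ring
    with commuting, locally finite derivations; they apply to differential
    functions because those over an open set form such a ring ([dfun_jet]).
    This needs the closure of smooth functions under the operations and the
    symmetry of second derivatives ([derive_comm]).

    For the two forms of the system, W = - (1/2) eta_{jl} v^j v^l when x is the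
    variational derivative of H1, so that P1 x is read off the formula above;
    P2 applied to the variational derivative of H2 is an algebraic identity
    between fluxes ([flux_energy]). *)

(** * Variational calculus in a jet algebra *)

(** The algebraic content of differential functions: [jet_coord k i] stands for
    the k-th x-derivative of v^i and [jet_pd k i] for the derivative with respect
    to it.  An explicit bound [jet_order] on the variables that occur turns the
    formal series over k into finite sums. *)
Record jet_algebra (N : nat) := JetAlgebra {
  jet_carrier :> comPzRingType;
  jet_pd : nat -> 'I_N -> jet_carrier -> jet_carrier;
  jet_order : jet_carrier -> nat;
  jet_coord : nat -> 'I_N -> jet_carrier;
  jet_pdD : forall k i, {morph jet_pd k i : a b / a + b};
  jet_pdM : forall k i a b,
    jet_pd k i (a * b) = jet_pd k i a * b + a * jet_pd k i b;
  jet_pdC : forall k i l j a,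
    jet_pd k i (jet_pd l j a) = jet_pd l j (jet_pd k i a);
  jet_pd_order : forall k i a, (jet_order a <= k)%N -> jet_pd k i a = 0;
  jet_pd_coord : forall k i l j,
    jet_pd k i (jet_coord l j) = ((k == l) && (i == j))%:R
}.

Arguments jet_pd : simpl never.
Arguments jet_coord : simpl never.

Section JetAlgebra.
Variables (N : nat) (A : jet_algebra N).
Implicit Types (a b c : A) (X Y : 'I_N -> A) (f g : nat -> 'I_N -> A).
Implicit Types (i j s : 'I_N) (k l n : nat).

Local Notation d := (@jet_pd N A).
Local Notation u := (@jet_coord N A).

Lemma jet_pd0 k i : d k i 0 = 0.
Proof. by apply: (addrI (d k i 0)); rewrite -jet_pdD !addr0. Qed.

Lemma jet_pdN k i : {morph d k i : a / - a}.
Proof.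
by move=> a; apply: (addrI (d k i a)); rewrite -jet_pdD !subrr jet_pd0.
Qed.

Lemma jet_pd_sum k i (I : Type) (r : seq I) (P : pred I) (F : I -> A) :
  d k i (\sum_(x <- r | P x) F x) = \sum_(x <- r | P x) d k i (F x).
Proof. exact: (big_morph _ (jet_pdD k i) (jet_pd0 k i)). Qed.

Lemma jet_pd_nat k i n : d k i n%:R = 0.
Proof.
have d1 : d k i 1 = 0.
  by apply: (addrI (d k i 1)); rewrite addr0 -[in RHS](mulr1 1) jet_pdM mulr1 mul1r.
by elim: n => [|n IH]; rewrite ?jet_pd0 // -[n.+1%:R]natr1 jet_pdD IH d1 addr0.
Qed.

Definition vanishes_from n a := forall k i, (n <= k)%N -> d k i a = 0.

Lemma vanishes_order a : vanishes_from (jet_order a) a.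
Proof. by move=> k i; exact: jet_pd_order. Qed.

Lemma vanishesD n a b : vanishes_from n a -> vanishes_from n b ->
  vanishes_from n (a + b).
Proof. by move=> an bn k i kn; rewrite jet_pdD an // bn // addr0. Qed.

Lemma vanishesM n a b : vanishes_from n a -> vanishes_from n b ->
  vanishes_from n (a * b).
Proof. by move=> an bn k i kn; rewrite jet_pdM an // bn // mul0r mulr0 addr0. Qed.

Lemma vanishes_sum n (I : Type) (r : seq I) (F : I -> A) :
  (forall x, vanishes_from n (F x)) -> vanishes_from n (\sum_(x <- r) F x).
Proof. by move=> Fn k i kn; rewrite jet_pd_sum big1 // => x _; exact: Fn. Qed.

Lemma vanishesW m n a : (m <= n)%N -> vanishes_from m a -> vanishes_from n a.
Proof. by move=> mn am k i nk; apply: am; exact: leq_trans nk. Qed.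

(** The vector field with components f; the total derivative, the partial
    derivatives and the evolutionary fields are all of this form, so that one
    commutator formula serves them all. *)
Definition vfield f a : A :=
  \sum_(k < jet_order a) \sum_i f k i * d k i a.

Lemma sum_vanishing (G : nat -> A) m n :
  (forall k, (m <= k)%N -> G k = 0) -> (forall k, (n <= k)%N -> G k = 0) ->
  \sum_(k < m) G k = \sum_(k < n) G k.
Proof.
wlog mn : m n / (m <= n)%N => [H Hm Hn|Hm _].
  by case/orP: (leq_total m n) => ?; [|symmetry]; apply: H.
rewrite -(subnKC mn) big_split_ord /= [X in _ = _ + X]big1 ?addr0 // => k _.
by rewrite Hm // leq_addr.
Qed.

Lemma vfieldE n f a : vanishes_from n a ->
  vfield f a = \sum_(k < n) \sum_i f k i * d k i a.
Proof.
move=> an; have G0 m : vanishes_from m a ->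
    forall k, (m <= k)%N -> \sum_i f k i * d k i a = 0.
  by move=> am k km; apply: big1 => i _; rewrite am // mulr0.
apply: (sum_vanishing (G := fun k => \sum_i f k i * d k i a)); apply: G0 => //.
exact: vanishes_order.
Qed.

Lemma vfieldD f : {morph vfield f : a b / a + b}.
Proof.
move=> a b; pose n := maxn (jet_order a) (jet_order b).
have an : vanishes_from n a := vanishesW (leq_maxl _ _) (@vanishes_order a).
have bn : vanishes_from n b := vanishesW (leq_maxr _ _) (@vanishes_order b).
rewrite (vfieldE f an) (vfieldE f bn) (vfieldE f (vanishesD an bn)).
rewrite -big_split /=; apply: eq_bigr => k _; rewrite -big_split /=.
by apply: eq_bigr => i _; rewrite jet_pdD mulrDr.
Qed.

Lemma vfieldM f a b : vfield f (a * b) = vfield f a * b + a * vfield f b.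
Proof.
pose n := maxn (jet_order a) (jet_order b).
have an : vanishes_from n a := vanishesW (leq_maxl _ _) (@vanishes_order a).
have bn : vanishes_from n b := vanishesW (leq_maxr _ _) (@vanishes_order b).
rewrite (vfieldE f an) (vfieldE f bn) (vfieldE f (vanishesM an bn)).
rewrite mulr_suml mulr_sumr -big_split /=; apply: eq_bigr => k _.
rewrite mulr_suml mulr_sumr -big_split /=; apply: eq_bigr => i _.
rewrite jet_pdM; ring.
Qed.

Lemma vfield0 f : vfield f 0 = 0.
Proof. by apply: (addrI (vfield f 0)); rewrite -vfieldD !addr0. Qed.

Lemma vfieldN f : {morph vfield f : a / - a}.
Proof.
by move=> a; apply: (addrI (vfield f a)); rewrite -vfieldD !subrr vfield0.
Qed.

Lemma vfieldB f : {morph vfield f : a b / a - b}.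
Proof. by move=> a b; rewrite vfieldD vfieldN. Qed.

Lemma vfield_sum f (I : Type) (r : seq I) (P : pred I) (F : I -> A) :
  vfield f (\sum_(x <- r | P x) F x) = \sum_(x <- r | P x) vfield f (F x).
Proof. exact: (big_morph _ (vfieldD f) (vfield0 f)). Qed.

Lemma sum_delta n k i (G : nat -> 'I_N -> A) :
  \sum_(l < n) \sum_j ((l == k :> nat) && (j == i))%:R * G l j
  = if (k < n)%N then G k i else 0.
Proof.
case: ifP => kn.
  rewrite (bigD1 (Ordinal kn)) //= [X in _ + X]big1 ?addr0 => [|l]; last first.
    rewrite -val_eqE /= => /negPf lk; apply: big1 => j _.
    by rewrite lk /= mul0r.
  rewrite (bigD1 i) //= !eqxx mul1r big1 ?addr0 // => j /negPf ->.
  by rewrite andbF mul0r.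
apply: big1 => l _; apply: big1 => j _; case: eqP => [lk|]; last by rewrite mul0r.
by rewrite -lk ltn_ord in kn.
Qed.

Lemma vfield_coord f k i : vfield f (u k i) = f k i.
Proof.
rewrite (@vfieldE k.+1) => [|l j kl]; last first.
  by rewrite jet_pd_coord gtn_eqF.
under eq_bigr => l _ do under eq_bigr => j _ do rewrite jet_pd_coord mulrC.
by rewrite (sum_delta _ _ _ (fun l j => f l j)) ltnSn.
Qed.

Lemma vfield_pd k i a :
  d k i a = vfield (fun l j => ((l == k) && (j == i))%:R) a.
Proof.
rewrite /vfield (sum_delta _ _ _ (fun l j => d l j a)).
by case: ltnP => // ka; rewrite vanishes_order.
Qed.

Lemma eq_vfield f g a : f =2 g -> vfield f a = vfield g a.
Proof. by move=> fg; do 2![apply: eq_bigr => ? _]; rewrite fg. Qed.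

Lemma vfield_nat f n : vfield f n%:R = 0.
Proof. by apply: big1 => k _; apply: big1 => i _; rewrite jet_pd_nat mulr0. Qed.

(** The second-order terms are symmetric because partial derivatives commute. *)
Lemma vfield_comm f g a :
  vfield f (vfield g a) - vfield g (vfield f a)
  = vfield (fun k i => vfield f (g k i) - vfield g (f k i)) a.
Proof.
have E f' g' : vfield f' (vfield g' a)
    = vfield (fun k i => vfield f' (g' k i)) a
      + \sum_(k < jet_order a) \sum_i \sum_(l < jet_order a) \sum_j
          f' l j * g' k i * d l j (d k i a).
  rewrite vfield_sum -big_split; apply: eq_bigr => k _.
  rewrite vfield_sum -big_split; apply: eq_bigr => i _.
  rewrite vfieldM (@vfieldE (jet_order a) _ (d k i a)) => [|l j al]; last first.
    by rewrite jet_pdC (vanishes_order j al) jet_pd0.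
  congr (_ + _); rewrite mulr_sumr; apply: eq_bigr => l _.
  rewrite mulr_sumr; apply: eq_bigr => j _; ring.
rewrite !E opprD addrACA [X in _ + X](_ : _ = 0) ?addr0; last first.
  apply/eqP; rewrite subr_eq0; apply/eqP.
  under eq_bigr => k _ do rewrite exchange_big /=.
  rewrite exchange_big /=; apply: eq_bigr => l _.
  under eq_bigr => k _ do rewrite exchange_big /=.
  rewrite exchange_big /=; apply: eq_bigr => j _.
  apply: eq_bigr => k _; apply: eq_bigr => i _.
  by rewrite jet_pdC mulrC [f _ _ * _]mulrC mulrC.
rewrite -sumrB; apply: eq_bigr => k _; rewrite -sumrB; apply: eq_bigr => i _.
by rewrite mulrBl.
Qed.

Lemma vfield_constant f c : vanishes_from 0 c -> vfield f c = 0.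
Proof. by move=> c0; rewrite (vfieldE _ c0) big_ord0. Qed.

Lemma vfield_order0 f a : vanishes_from 1 a ->
  vfield f a = \sum_s f 0%N s * d 0 s a.
Proof. by move=> a1; rewrite (vfieldE _ a1) big_ord1. Qed.

Definition dx : A -> A := vfield (fun k i => u k.+1 i).

Lemma dx_coord k i : dx (u k i) = u k.+1 i.
Proof. exact: vfield_coord. Qed.

Lemma dxD : {morph dx : a b / a + b}. Proof. exact: vfieldD. Qed.
Lemma dxN : {morph dx : a / - a}. Proof. exact: vfieldN. Qed.
Lemma dxB : {morph dx : a b / a - b}. Proof. exact: vfieldB. Qed.
Lemma dx0 : dx 0 = 0. Proof. exact: vfield0. Qed.
Lemma dxM a b : dx (a * b) = dx a * b + a * dx b.
Proof. exact: vfieldM. Qed.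
Lemma dx_sum (I : Type) (r : seq I) (P : pred I) (F : I -> A) :
  dx (\sum_(x <- r | P x) F x) = \sum_(x <- r | P x) dx (F x).
Proof. exact: vfield_sum. Qed.

Lemma dx_constM c a : vanishes_from 0 c -> dx (c * a) = c * dx a.
Proof.
by move=> c0; rewrite /dx vfieldM vfield_constant // mul0r add0r.
Qed.

Lemma dx_order0 a : vanishes_from 1 a -> dx a = \sum_s u 1 s * d 0 s a.
Proof. exact: vfield_order0. Qed.

Lemma iter_dxD n : {morph iter n dx : a b / a + b}.
Proof. by elim: n => //= n IH a b; rewrite /= IH dxD. Qed.

Lemma iter_dxB n : {morph iter n dx : a b / a - b}.
Proof. by elim: n => //= n IH a b; rewrite /= IH dxB. Qed.

Lemma iter_dx0 n : iter n dx 0 = 0.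
Proof. by elim: n => //= n ->; rewrite dx0. Qed.

(** Only the coefficient u_{l+1} of dx depends on the variable of order k, for
    k = l + 1; this makes the Euler operator telescope on total derivatives. *)
Lemma pd_dx k i a :
  d k i (dx a) = dx (d k i a) + (if k is k'.+1 then d k' i a else 0).
Proof.
pose e k l j : A := ((l == k) && (j == i))%:R.
apply/eqP; rewrite addrC -subr_eq !(vfield_pd k) vfield_comm; apply/eqP.
rewrite (@eq_vfield _ (fun l j => if k is k'.+1 then e k' l j else 0)).
  case: k => [|k']; last by rewrite -vfield_pd.
  by apply: big1 => l _; apply: big1 => j _; rewrite mul0r.
move=> l j; rewrite vfield_coord; rewrite vfield_nat subr0; by case: k.
Qed.

(** The evolutionary vector field of characteristic X: the fields v^i vary
    with velocity X i, and the field commutes with dx. *)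
Definition evol X : A -> A := vfield (fun k i => iter k dx (X i)).

Lemma evol_dx X a : evol X (dx a) = dx (evol X a).
Proof.
apply/eqP; rewrite -subr_eq0 vfield_comm; apply/eqP.
apply: big1 => k _; apply: big1 => i _.
by rewrite vfield_coord /= subrr mul0r.
Qed.

Lemma evol_iter_dx X k a : evol X (iter k dx a) = iter k dx (evol X a).
Proof. by elim: k => //= k <-; rewrite evol_dx. Qed.

Lemma evol_comm X Y a :
  evol X (evol Y a) - evol Y (evol X a)
  = evol (fun i => evol X (Y i) - evol Y (X i)) a.
Proof.
rewrite vfield_comm; apply: eq_vfield => k i.
by rewrite iter_dxB -!evol_iter_dx.
Qed.

(** Equality of the functionals with densities a and b. *)
Definition eq_int a b := exists F : A, a - b = dx F.
Local Notation "a ~ b" := (eq_int a b) (at level 70).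

Lemma eq_int_refl a : a ~ a.
Proof. by exists 0; rewrite subrr dx0. Qed.

Lemma eq_int_eq a b : a = b -> a ~ b.
Proof. by move=> ->; exact: eq_int_refl. Qed.

Lemma eq_int_sym a b : a ~ b -> b ~ a.
Proof. by case=> F E; exists (- F); rewrite dxN -E opprB. Qed.

Lemma eq_int_trans b a c : a ~ b -> b ~ c -> a ~ c.
Proof.
by case=> F E [G E']; exists (F + G); rewrite dxD -E -E' addrA subrK.
Qed.

Lemma eq_intD a b a' b' : a ~ a' -> b ~ b' -> a + b ~ a' + b'.
Proof.
by case=> F E [G E']; exists (F + G); rewrite dxD -E -E'; ring.
Qed.

Lemma eq_intN a b : a ~ b -> - a ~ - b.
Proof. by case=> F E; exists (- F); rewrite dxN -E; ring. Qed.

Lemma eq_intB a b a' b' : a ~ a' -> b ~ b' -> a - b ~ a' - b'.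
Proof. by move=> Ha Hb; apply: eq_intD => //; exact: eq_intN. Qed.

Lemma eq_int_sum (I : Type) (r : seq I) (F G : I -> A) :
  (forall x, F x ~ G x) -> \sum_(x <- r) F x ~ \sum_(x <- r) G x.
Proof.
move=> FG; apply: (big_ind2 (fun a b => a ~ b)) => //.
- exact: eq_int_refl.
- by move=> *; exact: eq_intD.
Qed.

Lemma dx_int a : dx a ~ 0.
Proof. by exists a; rewrite subr0. Qed.

Lemma int_parts a b : dx a * b ~ - (a * dx b).
Proof. by exists (a * b); rewrite dxM opprK. Qed.

Lemma int_parts_iter k a b : iter k dx a * b ~ (-1) ^+ k * (a * iter k dx b).
Proof.
elim: k b => [|k IH] b; first by rewrite expr0 mul1r; exact: eq_int_refl.
apply: (eq_int_trans (int_parts _ _)).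
apply: (@eq_int_trans (- ((-1) ^+ k * (a * iter k dx (dx b))))).
  exact/eq_intN/IH.
by apply: eq_int_eq; rewrite iterSr exprS mulN1r mulNr.
Qed.

Definition euler i a : A :=
  \sum_(k < jet_order a) (-1) ^+ k * iter k dx (d k i a).

Lemma eulerE n i a : vanishes_from n a ->
  euler i a = \sum_(k < n) (-1) ^+ k * iter k dx (d k i a).
Proof.
move=> an.
have G0 m : vanishes_from m a ->
    forall k, (m <= k)%N -> (-1) ^+ k * iter k dx (d k i a) = 0.
  by move=> am k km; rewrite am // iter_dx0 mulr0.
apply: (sum_vanishing (G := fun k => (-1) ^+ k * iter k dx (d k i a)));
  apply: G0 => //.
exact: vanishes_order.
Qed.

Lemma eulerD i : {morph euler i : a b / a + b}.
Proof.
move=> a b; pose n := maxn (jet_order a) (jet_order b).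
have an : vanishes_from n a := vanishesW (leq_maxl _ _) (@vanishes_order a).
have bn : vanishes_from n b := vanishesW (leq_maxr _ _) (@vanishes_order b).
rewrite (eulerE i an) (eulerE i bn) (eulerE i (vanishesD an bn)).
rewrite -big_split /=; apply: eq_bigr => k _.
by rewrite jet_pdD iter_dxD mulrDr.
Qed.

Lemma euler_constM i c a : vanishes_from 0 c -> euler i (c * a) = c * euler i a.
Proof.
move=> c0; have an := @vanishes_order a.
have cE m x : iter m dx (c * x) = c * iter m dx x.
  by elim: m => //= m ->; rewrite dx_constM.
rewrite (eulerE i an) (eulerE i (vanishesM (vanishesW (leq0n _) c0) an)) mulr_sumr.
apply: eq_bigr => k _; by rewrite mulrCA jet_pdM c0 // mul0r add0r cE.
Qed.

Lemma euler_order0 i a : vanishes_from 1 a -> euler i a = d 0 i a.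
Proof. by move=> a1; rewrite (eulerE i a1) big_ord1 expr0 mul1r. Qed.

Lemma euler_dx i a : euler i (dx a) = 0.
Proof.
set n := jet_order a.
rewrite (@eulerE n.+1) => [|k j kn]; last first.
  rewrite pd_dx vanishes_order ?dx0 ?add0r; last exact: ltnW.
  by case: k kn => // k kn; rewrite vanishes_order.
under eq_bigr => k _ do rewrite pd_dx iter_dxD mulrDr -iterSr.
rewrite big_split /= big_ord_recr /= vanishes_order // iter_dx0 dx0 mulr0 addr0.
rewrite [X in _ + X]big_ord_recl /= mulr0 add0r -big_split big1 // => k _ /=.
by rewrite /bump /= add1n exprS mulN1r mulNr subrr.
Qed.

Lemma euler_int i a b : a ~ b -> euler i a = euler i b.
Proof.
case=> F /eqP; rewrite subr_eq => /eqP ->.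
by rewrite eulerD euler_dx add0r.
Qed.

(** First variation formula. *)
Lemma evol_euler X a : evol X a ~ \sum_i X i * euler i a.
Proof.
rewrite /evol /vfield exchange_big; apply: eq_int_sum => i.
rewrite mulr_sumr; apply: eq_int_sum => k.
apply: (eq_int_trans (int_parts_iter _ _ _)).
by apply: eq_int_eq; rewrite mulrCA.
Qed.

Lemma evol_int X a b : a ~ b -> evol X a ~ evol X b.
Proof. by case=> F E; exists (evol X F); rewrite -evol_dx -E /evol vfieldB. Qed.

(** The evolutionary field of characteristic v_x is dx itself.  This is why
    the nonlocal term of the operators is a differential function on every
    variational derivative. *)
Lemma coord_euler a : \sum_i u 1 i * euler i a ~ 0.
Proof.
apply: eq_int_trans (dx_int a); apply: eq_int_sym.
have -> : dx a = evol (u 1) a; last exact: evol_euler.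
by apply: eq_vfield => k i; elim: k => //= k <-; rewrite dx_coord.
Qed.

(** Both sides come from the second variation of a: the commutator of two
    evolutionary fields is evolutionary, and its first variation accounts for
    all the terms in which the fields differentiate each other. *)
Lemma euler_self_adjoint X Y a :
  \sum_i evol X (euler i a) * Y i ~ \sum_i evol Y (euler i a) * X i.
Proof.
have H X' Y' : evol X' (evol Y' a)
    ~ \sum_i evol X' (Y' i) * euler i a + \sum_i evol X' (euler i a) * Y' i.
  apply: (eq_int_trans (evol_int X' (evol_euler Y' a))); apply: eq_int_eq.
  rewrite /evol vfield_sum -big_split; apply: eq_bigr => i _ /=.
  by rewrite vfieldM [Y' i * _]mulrC.
have := eq_intB (H X Y) (H Y X); rewrite evol_comm => /eq_int_sym H1.
have {H1} := eq_int_trans H1 (evol_euler _ _).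
rewrite /=.
have -> : \sum_i (evol X (Y i) - evol Y (X i)) * euler i a
    = \sum_i evol X (Y i) * euler i a - \sum_i evol Y (X i) * euler i a.
  by rewrite -sumrB; apply: eq_bigr => i _; rewrite mulrBl.
by case=> F E; exists F; rewrite -E; ring.
Qed.

End JetAlgebra.

(** * Skew-symmetry and the Jacobi identity *)

Section PoissonPencil.
Variables (N : nat) (A : jet_algebra N).

Local Notation d := (@jet_pd N A).
Local Notation u := (@jet_coord N A).
Local Notation v := (u 0).
Local Notation D := (@dx N A).
Local Notation E := (@euler N A).
Local Notation "a ~ b" := (@eq_int N A a b) (at level 70).

Variables (B : 'I_N -> 'I_N -> A) (K : A).
Hypothesis B_order : forall i j, vanishes_from 1 (B i j).
Hypothesis K_const : vanishes_from 0 K.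

Implicit Types (i j l s : 'I_N) (x y z p q r Y : 'I_N -> A) (W Z w : A).

(** These instances fix one inheritance path from rings to additive structures,
    so that rewriting can chain them. *)
Let sumB (I : Type) (r : seq I) (P : pred I) (F G : I -> A) :
  \sum_(i <- r | P i) (F i - G i)
  = \sum_(i <- r | P i) F i - \sum_(i <- r | P i) G i := sumrB r P F G.

Let sumD (I : Type) (r : seq I) (P : pred I) (F G : I -> A) :
  \sum_(i <- r | P i) (F i + G i)
  = \sum_(i <- r | P i) F i + \sum_(i <- r | P i) G i := big_split _ r P F G.

Let mulAr_sum (I : Type) (r : seq I) (P : pred I) (F : I -> A) (a : A) :
  a * (\sum_(i <- r | P i) F i) = \sum_(i <- r | P i) a * F i := mulr_sumr r P F a.

Let mulAl_sum (I : Type) (r : seq I) (P : pred I) (F : I -> A) (a : A) :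
  (\sum_(i <- r | P i) F i) * a = \sum_(i <- r | P i) F i * a := mulr_suml r P F a.

Definition pairing p q : A := \sum_s p s * q s.
Local Notation "<[ p , q ]>" := (pairing p q).

Definition der p i : A := D (p i).

Lemma pairingC p q : <[p, q]> = <[q, p]>.
Proof. by apply: eq_bigr => s _; rewrite mulrC. Qed.

Lemma dx_pairing p q : D <[p, q]> = <[der p, q]> + <[p, der q]>.
Proof. by rewrite dx_sum -big_split; apply: eq_bigr => s _; rewrite dxM. Qed.

Lemma dxK a : D (K * a) = K * D a.
Proof. exact: dx_constM. Qed.

Lemma eq_intK (a b : A) : a ~ b -> K * a ~ K * b.
Proof. by case=> F FE; exists (K * F); rewrite dxK -FE mulrBr. Qed.

(** The image of the covector x under the operator with
    metric B + B^T - K v v, with the nonlocal term expressed by W. *)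
Definition ham_field x W s : A :=
  D (\sum_j B s j * x j + K * (v s * W)) + \sum_j B j s * D (x j).

(** W is w - v^j x_j, where w is an antiderivative of v^j_x x_j; its own
    derivative contains the x_j only through their derivatives. *)
Definition potential x W := D W = - <[v, der x]>.

Definition skew_form x y : A :=
  \sum_s \sum_j B s j * (x j * D (y s) - D (x s) * y j).

Lemma ham_field_pairing x y Z :
  <[x, ham_field y Z]> ~ skew_form x y - K * (<[v, der x]> * Z).
Proof.
rewrite {1}/pairing.
under eq_bigr => s _ do rewrite mulrDr.
rewrite big_split /=.
have H : \sum_s x s * D (\sum_j B s j * y j + K * (v s * Z))
    ~ - \sum_s D (x s) * (\sum_j B s j * y j + K * (v s * Z)).
  rewrite -sumrN; apply: eq_int_sum => s; apply: eq_int_sym.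
  by have := eq_intN (int_parts (x s) (\sum_j B s j * y j + K * (v s * Z)));
    rewrite opprK.
apply: (eq_int_trans (eq_intD H (eq_int_refl _))); apply: eq_int_eq.
have -> : skew_form x y = \sum_j \sum_s B s j * (x j * D (y s))
    - \sum_s \sum_j B s j * (D (x s) * y j).
  rewrite [X in X - _]exchange_big -sumB; apply: eq_bigr => s _.
  by rewrite -sumB; apply: eq_bigr => j _; rewrite mulrBr.
have -> : \sum_s D (x s) * (\sum_j B s j * y j + K * (v s * Z))
    = \sum_s \sum_j B s j * (D (x s) * y j) + K * (<[v, der x]> * Z).
  rewrite mulAl_sum mulAr_sum -big_split; apply: eq_bigr => s _ /=.
  rewrite mulrDr mulAr_sum; congr (_ + _); last by rewrite /der; ring.
  by apply: eq_bigr => j _; ring.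
have -> : \sum_s x s * (\sum_j B j s * D (y j))
    = \sum_j \sum_s B s j * (x j * D (y s)); last by ring.
by apply: eq_bigr => j _; rewrite mulAr_sum; apply: eq_bigr => s _; ring.
Qed.

Lemma skew_formC x y : skew_form x y = - skew_form y x.
Proof.
rewrite -sumrN; apply: eq_bigr => s _; rewrite -sumrN; apply: eq_bigr => j _.
ring.
Qed.

Lemma ham_field_skew x y W Z : potential x W -> potential y Z ->
  <[x, ham_field y Z]> ~ - <[y, ham_field x W]>.
Proof.
move=> xW yZ; apply: (eq_int_trans (ham_field_pairing _ _ _)); apply: eq_int_sym.
apply: (eq_int_trans (eq_intN (ham_field_pairing _ _ _))).
rewrite skew_formC opprD opprK; apply: eq_intD; first exact: eq_int_refl.
apply: (@eq_int_trans _ _ (K * (D W * Z))).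
  have := eq_intN (eq_intK (int_parts Z W)).
  by rewrite yZ mulNr !mulrN !opprK [Z * D W]mulrC.
apply: eq_int_eq; rewrite xW; ring.
Qed.

Section Evolution.
Variable Y : 'I_N -> A.
Local Notation "\d a" := (@evol N A Y a) (at level 10, a at level 8).

Lemma evol_coord s : \d (v s) = Y s.
Proof. exact: vfield_coord. Qed.

Lemma evol_order0 (a : A) : vanishes_from 1 a -> \d a = \sum_s Y s * d 0 s a.
Proof. exact: vfield_order0. Qed.

Lemma evol_potential x W : potential x W ->
  D (\d W) = - <[Y, der x]> - <[v, der (fun i => \d (x i))]>.
Proof.
move=> xW; rewrite -evol_dx xW /evol vfieldN vfield_sum -opprD -big_split /=.
congr (- _); apply: eq_bigr => s _.
by rewrite vfieldM -!/(evol _ _) evol_coord evol_dx.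
Qed.

Definition structure_form s x y : A := \sum_i \sum_j d 0 s (B i j) * (x j * y i).

(** The coefficient of the velocity of v^s in the variation of the bracket, when
    the covectors x and y are held fixed. *)
Definition variation s x W y Z : A :=
  structure_form s x (der y) - structure_form s y (der x)
  + K * (W * D (y s) - Z * D (x s)).

Lemma evol_skew_form x y :
  \d (skew_form x y)
  = \sum_s Y s * (structure_form s x (der y) - structure_form s y (der x))
    + skew_form (fun i => \d (x i)) y - skew_form (fun i => \d (y i)) x.
Proof.
have -> : \sum_s Y s * (structure_form s x (der y) - structure_form s y (der x))
    = \sum_i \sum_j \d (B i j) * (x j * D (y i) - D (x i) * y j).
  under eq_bigr => s _ do rewrite -sumB mulAr_sum.
  rewrite exchange_big /=; apply: eq_bigr => i _.
  under eq_bigr => s _ do rewrite -sumB mulAr_sum.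
  rewrite exchange_big /=; apply: eq_bigr => j _.
  rewrite evol_order0 // mulAl_sum; apply: eq_bigr => s _.
  rewrite /der; ring.
rewrite /evol vfield_sum -big_split -sumB; apply: eq_bigr => s _ /=.
rewrite vfield_sum -big_split -sumB; apply: eq_bigr => j _ /=.
rewrite vfieldM vfieldB !vfieldM -!/(evol _ _) !evol_dx; ring.
Qed.

(** The variations of x and y reassemble into images of the operator, since
    [ham_field_pairing] holds for an arbitrary covector on the left; the variation
    of the potentials supplies the remaining K-terms of [variation]. *)
Lemma evol_bracket x W y Z : potential x W -> potential y Z ->
  \d <[x, ham_field y Z]> ~
    \sum_s Y s * variation s x W y Z
    + (\sum_s \d (x s) * ham_field y Z s - \sum_s \d (y s) * ham_field x W s).
Proof.
move=> xW yZ; apply: (eq_int_trans (evol_int _ (ham_field_pairing _ _ _))).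
rewrite /evol vfieldB vfieldM (vfield_constant _ K_const) mul0r add0r -!/(evol _ _).
rewrite -[<[v, der x]>]opprK -xW mulNr /evol vfieldN mulrN opprK vfieldM.
rewrite -!/(evol _ _) evol_dx.
set x' := fun s => \d (x s); set y' := fun s => \d (y s).
have Hx : <[x', ham_field y Z]> ~ _ := ham_field_pairing x' y Z.
have Hy : <[y', ham_field x W]> ~ _ := ham_field_pairing y' x W.
apply: eq_int_sym; apply: (eq_int_trans (eq_intD (eq_int_refl _) (eq_intB Hx Hy))).
apply: eq_int_sym.
rewrite mulrDr.
apply: (@eq_int_trans _ _ (\d (skew_form x y) + (K * (D (\d W) * Z) - K * (W * D (\d Z))))).
  apply: eq_intD; first exact: eq_int_refl.
  apply: eq_intD; first exact: eq_int_refl.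
  by rewrite -mulrN; apply: eq_intK; exact: int_parts.
apply: eq_int_eq; rewrite (evol_potential xW) (evol_potential yZ) evol_skew_form.
rewrite /variation.
under [in RHS]eq_bigr => s _ do rewrite mulrDr.
rewrite big_split /=.
have -> : \sum_s Y s * (K * (W * D (y s) - Z * D (x s)))
   = K * (W * <[Y, der y]> - Z * <[Y, der x]>).
  rewrite /pairing !mulAr_sum -[X in K * X]sumB mulAr_sum.
  by apply: eq_bigr => s _; rewrite /der; ring.
rewrite -/x' -/y'; ring.
Qed.

End Evolution.

Definition metric_coef i j : A := B i j + B j i - K * v i * v j.

Hypothesis metric_sym : forall i j l,
  \sum_s metric_coef s l * d 0 s (B i j) = \sum_s metric_coef s i * d 0 s (B l j).
Hypothesis hessian_comm : forall i j l,
  \sum_s D (B s l) * d 0 s (B i j) = \sum_s D (B s j) * d 0 s (B i l).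

(** The usual form of the operator, with the metric as coefficient of d/dx. *)
Lemma ham_fieldE x W s : potential x W ->
  ham_field x W s = \sum_l metric_coef s l * D (x l) + \sum_l D (B s l) * x l
    + K * (u 1 s * W).
Proof.
move=> xW; rewrite /ham_field dxD dxK dxM dx_coord xW dx_sum.
have -> : \sum_l metric_coef s l * D (x l)
   = \sum_l B s l * D (x l) + \sum_l B l s * D (x l) - K * (v s * <[v, der x]>).
  rewrite /pairing !mulAr_sum -sumD -sumB; apply: eq_bigr => l _.
  rewrite /metric_coef /der; ring.
under eq_bigr => j _ do rewrite dxM.
rewrite big_split /=; ring.
Qed.

Let raise p s : A := \sum_l metric_coef s l * p l.
Let transport p s : A := \sum_l D (B s l) * p l.
Let pairing_structure p x y := <[p, fun s => structure_form s x y]>.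

Lemma pairing_structureE (C : 'I_N -> 'I_N -> A) p x y :
  pairing_structure (fun s => \sum_l C s l * p l) x y
  = \sum_i \sum_j \sum_l (\sum_s C s l * d 0 s (B i j)) * (p l * y i * x j).
Proof.
rewrite /pairing_structure /pairing.
under eq_bigr => s _ do rewrite mulAr_sum.
rewrite exchange_big /=; apply: eq_bigr => i _.
under eq_bigr => s _ do rewrite mulAr_sum.
rewrite exchange_big /=; apply: eq_bigr => j _.
under [RHS]eq_bigr => l _ do rewrite mulAl_sum.
rewrite [RHS]exchange_big /=; apply: eq_bigr => s _.
rewrite mulAl_sum; apply: eq_bigr => l _; ring.
Qed.

Lemma raise_structureC p x y :
  pairing_structure (raise p) x y = pairing_structure (raise y) x p.
Proof.
rewrite !pairing_structureE.
under eq_bigr => i _ do rewrite exchange_big /=.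
rewrite exchange_big /=; apply: eq_bigr => i _.
rewrite exchange_big /=; apply: eq_bigr => j _; apply: eq_bigr => l _.
rewrite metric_sym; ring.
Qed.

Lemma transport_structureC p x y :
  pairing_structure (transport p) x y = pairing_structure (transport x) p y.
Proof.
rewrite !pairing_structureE; apply: eq_bigr => i _.
rewrite exchange_big /=; apply: eq_bigr => l _; apply: eq_bigr => j _.
rewrite hessian_comm; ring.
Qed.

Lemma raiseC p q : <[raise p, q]> = <[raise q, p]>.
Proof.
rewrite /pairing.
under eq_bigr => s _ do rewrite mulAl_sum.
rewrite exchange_big /=; apply: eq_bigr => l _.
rewrite mulAl_sum; apply: eq_bigr => s _; rewrite /metric_coef; ring.
Qed.

Lemma coord_structure x y : pairing_structure (u 1) x y = <[transport x, y]>.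
Proof.
rewrite /pairing_structure /pairing.
under eq_bigr => s _ do rewrite mulAr_sum.
rewrite exchange_big /=; apply: eq_bigr => i _; rewrite mulAl_sum.
under eq_bigr => s _ do rewrite mulAr_sum.
rewrite exchange_big /=; apply: eq_bigr => j _.
rewrite dx_order0 // !mulAl_sum; apply: eq_bigr => s _; ring.
Qed.

(** Expansion into contractions whose symmetries are known: [raise] by the
    second condition and [transport] by the first one; the K-terms with v_x become
    derivatives of B by the chain rule. *)
Lemma ham_field_variation x W y Z z w : potential z w ->
  \sum_s ham_field z w s * variation s x W y Z
  = pairing_structure (raise (der z)) x (der y)
    - pairing_structure (raise (der z)) y (der x)
    + (pairing_structure (transport z) x (der y)
       - pairing_structure (transport z) y (der x))
    + K * w * (<[transport x, der y]> - <[transport y, der x]>)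
    + K * W * (<[raise (der z), der y]> + <[transport z, der y]>
               + K * w * <[u 1, der y]>)
    - K * Z * (<[raise (der z), der x]> + <[transport z, der x]>
               + K * w * <[u 1, der x]>).
Proof.
move=> zw; rewrite -(coord_structure x) -(coord_structure y).
rewrite /pairing_structure /pairing !(mulrBr, mulrDr) !mulrA !mulAr_sum.
rewrite -!(sumB, sumD); apply: eq_bigr => s _.
rewrite (ham_fieldE s zw) /variation /raise /transport /der; ring.
Qed.

(** By the symmetries of [raise] and [transport], every contraction occurs twice
    in the cyclic sum, with opposite signs. *)
Lemma variation_cyclic x W y Z z w :
  potential x W -> potential y Z -> potential z w ->
  \sum_s ham_field z w s * variation s x W y Z
  + \sum_s ham_field x W s * variation s y Z z w
  + \sum_s ham_field y Z s * variation s z w x W = 0.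
Proof.
move=> xW yZ zw; rewrite !ham_field_variation //.
rewrite (raise_structureC (der z) x (der y)) (raise_structureC (der z) y).
rewrite (raise_structureC (der x) z).
rewrite (transport_structureC z x) (transport_structureC z y).
rewrite (transport_structureC y x).
rewrite (raiseC (der z) (der y)) (raiseC (der z) (der x)) (raiseC (der x) (der y)).
ring.
Qed.

(** In the cyclic sum of [evol_bracket] the variations of the covectors cancel
    by [euler_self_adjoint] and the rest by [variation_cyclic]. *)
Lemma jacobi_identity (a b c : A) Wa Wb Wc :
  potential (E^~ a) Wa -> potential (E^~ b) Wb -> potential (E^~ c) Wc ->
  <[E^~ <[E^~ a, ham_field (E^~ b) Wb]>, ham_field (E^~ c) Wc]>
  + <[E^~ <[E^~ b, ham_field (E^~ c) Wc]>, ham_field (E^~ a) Wa]>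
  + <[E^~ <[E^~ c, ham_field (E^~ a) Wa]>, ham_field (E^~ b) Wb]> ~ 0.
Proof.
move=> pa pb pc.
have step (x : A) W (y : A) Z (z : A) w : potential (E^~ x) W -> potential (E^~ y) Z ->
    <[E^~ <[E^~ x, ham_field (E^~ y) Z]>, ham_field (E^~ z) w]> ~
    \sum_s ham_field (E^~ z) w s * variation s (E^~ x) W (E^~ y) Z
    + (\sum_s evol (ham_field (E^~ z) w) (E s x) * ham_field (E^~ y) Z s
       - \sum_s evol (ham_field (E^~ z) w) (E s y) * ham_field (E^~ x) W s).
  move=> xW yZ; apply: eq_int_trans (evol_bracket _ xW yZ).
  by rewrite pairingC; apply: eq_int_sym; exact: evol_euler.
apply: (eq_int_trans (eq_intD (eq_intD (step _ _ _ _ c Wc pa pb)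
  (step _ _ _ _ a Wa pb pc)) (step _ _ _ _ b Wb pc pa))).
set Xa := ham_field _ Wa; set Xb := ham_field _ Wb; set Xc := ham_field _ Wc.
have := variation_cyclic pa pb pc; rewrite -/Xa -/Xb -/Xc.
have Ha := euler_self_adjoint Xc Xb a.
have Hb := euler_self_adjoint Xa Xc b.
have Hc := euler_self_adjoint Xb Xa c.
case: (eq_intD (eq_intD Ha Hb) Hc) => F FE cyc.
exists F; rewrite -FE subr0.
by move: cyc => /eqP; rewrite -addrA addr_eq0 => /eqP ->; ring.
Qed.
End PoissonPencil.

(** * Smooth functions and the symmetry of second derivatives *)

Section Smooth.
Variables (R : realType) (V : normedModType R).
Implicit Types (A : set V) (f g : V -> R) (x v w a b : V).

Lemma near_eq_differentiable f g x :
  (\near x, f x = g x) -> differentiable f x -> differentiable g x.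
Proof.
move=> fg df; have [dc dE] := (diff_locallyP x f).1 df.
have gE : g \o shift x = cst (g x) + 'd f x +o_ 0 id.
  apply/eqaddoP => e e0; have /eqaddoP/(_ e e0) := dE.
  have fg0 : \forall h \near (0 : V), f (h + x) = g (h + x).
    move: fg; rewrite (near_shift 0) /=.
    by apply: filterS => h /=; rewrite subr0.
  apply: filterS2 fg0 => h fgh.
  by rewrite !fctE /= fgh (nbhs_singleton fg).
by apply/diff_locallyP; rewrite (diff_unique dc gE).
Qed.

(** Being smooth is the conjunction over n of these conditions, which unlike
    [smooth_on] can be proved by induction for sums and products. *)
Fixpoint smooth_upto n A f : Prop :=
  (forall x, A x -> differentiable f x) /\
  (if n is n'.+1 then forall w, smooth_upto n' A ('D_w f) else True).

Lemma smooth_diff A f x : smooth_on A f -> A x -> differentiable f x.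
Proof. by move=> sf; exact: (sf [::]). Qed.

Lemma smooth_derive A f w : smooth_on A f -> smooth_on A ('D_w f).
Proof. by move=> sf s x Ax; have := sf (rcons s w) x Ax; rewrite foldr_rcons. Qed.

Lemma smooth_uptoP A f : smooth_on A f <-> forall n, smooth_upto n A f.
Proof.
split=> [sf n|].
  elim: n f sf => [|n IH] f sf; split=> //; try by move=> x; exact: smooth_diff.
  by move=> w; apply: IH; exact: smooth_derive.
move=> cf s; elim/last_ind: s f cf => [|s w IH] f cf x Ax.
  by have [+ _] := cf 0; exact.
by rewrite foldr_rcons; apply: IH => // n; have [_ /(_ w)] := cf n.+1.
Qed.

Lemma smooth_uptoW n A f : smooth_upto n.+1 A f -> smooth_upto n A f.
Proof.
elim: n f => [|n IH] f [df cf]; split => // w; exact: IH.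
Qed.

Lemma smooth_upto_ext n A f g : open A -> (forall x, A x -> f x = g x) ->
  smooth_upto n A f -> smooth_upto n A g.
Proof.
move=> oA; have nearA h k x : (forall x, A x -> h x = k x :> R) -> A x ->
    \near x, h x = k x.
  by move=> hk Ax; near do apply: hk; exact: open_nbhs_nbhs.
elim: n f g => [|n IH] f g fg [df cf]; split => //.
- by move=> x Ax; apply: near_eq_differentiable (df x Ax); exact: nearA.
- by move=> x Ax; apply: near_eq_differentiable (df x Ax); exact: nearA.
- move=> w; apply: IH (cf w) => x Ax; apply: near_eq_derive; exact: nearA.
Unshelve. all: by end_near. Qed.

Lemma smooth_uptoD n A f g : open A -> smooth_upto n A f -> smooth_upto n A g ->
  smooth_upto n A (f + g).
Proof.
move=> oA; elim: n f g => [|n IH] f g [df cf] [dg cg]; split => //.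
- by move=> x Ax; apply: differentiableD; [exact: df|exact: dg].
- by move=> x Ax; apply: differentiableD; [exact: df|exact: dg].
move=> w; apply: (smooth_upto_ext oA) (IH _ _ (cf w) (cg w)) => x Ax.
by rewrite deriveD //; apply: diff_derivable; [exact: df|exact: dg].
Qed.

Lemma smooth_uptoM n A f g : open A -> smooth_upto n A f -> smooth_upto n A g ->
  smooth_upto n A (f * g).
Proof.
move=> oA; elim: n f g => [|n IH] f g cf cg; split => //.
- by move=> x Ax; apply: differentiableM; [exact: cf.1|exact: cg.1].
- by move=> x Ax; apply: differentiableM; [exact: cf.1|exact: cg.1].
move=> w; apply: (smooth_upto_ext oA (f := f * 'D_w g + g * 'D_w f)).
  move=> x Ax.
  by rewrite deriveM //; apply: diff_derivable; [exact: cf.1|exact: cg.1].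
apply: smooth_uptoD => //; apply: IH;
  by [exact: smooth_uptoW|exact: cg.2|exact: smooth_uptoW|exact: cf.2].
Qed.

Lemma smooth_upto_cst n A (c : R) : smooth_upto n A (cst c).
Proof.
elim: n c => [|n IH] c; split => //; try by move=> x _; exact: differentiable_cst.
move=> w; have -> : 'D_w (cst c) = cst 0; last exact: IH.
by apply/funext => x; rewrite derive_cst.
Qed.

Lemma smoothD A f g : open A -> smooth_on A f -> smooth_on A g ->
  smooth_on A (f + g).
Proof.
move=> oA /smooth_uptoP ? /smooth_uptoP ?.
by apply/smooth_uptoP => n; exact: smooth_uptoD.
Qed.

Lemma smoothM A f g : open A -> smooth_on A f -> smooth_on A g ->
  smooth_on A (f * g).
Proof.
move=> oA /smooth_uptoP ? /smooth_uptoP ?.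
by apply/smooth_uptoP => n; exact: smooth_uptoM.
Qed.

Lemma smooth_cst A (c : R) : smooth_on A (cst c).
Proof. by apply/smooth_uptoP => n; exact: smooth_upto_cst. Qed.

Lemma is_derive_line f y a s : differentiable f (y + s *: a) ->
  is_derive s 1 (fun t : R => f (y + t *: a)) ('D_a f (y + s *: a)).
Proof.
move=> df.
have E : (fun h : R => h^-1 *: ((fun t : R => f (y + t *: a)) (h *: 1 + s)
             - (fun t : R => f (y + t *: a)) s))
       = (fun h : R => h^-1 *: (f (h *: a + (y + s *: a)) - f (y + s *: a))).
  apply/funext => h; congr (_ *: (f _ - _)).
  by rewrite /= [h *: 1]mulr1 scalerDl addrCA.
apply: DeriveDef; last by rewrite /derive E.
by rewrite /derivable E; exact: diff_derivable.
Qed.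

Lemma mean_value_line f y a (t : R) : 0 < t ->
  (forall s, 0 <= s <= t -> differentiable f (y + s *: a)) ->
  exists2 s, 0 <= s <= t & f (y + t *: a) - f y = 'D_a f (y + s *: a) * t.
Proof.
move=> t0 df.
have dl s : 0 <= s <= t ->
    is_derive s 1 (fun t : R => f (y + t *: a)) ('D_a f (y + s *: a)).
  by move=> /df; exact: is_derive_line.
have [| |s] := @MVT_segment R (fun t : R => f (y + t *: a))
    (fun s => 'D_a f (y + s *: a)) 0 t (ltW t0).
- by move=> s; rewrite in_itv /= => /andP[/ltW s0 /ltW st]; apply: dl; rewrite s0.
- apply: derivable_within_continuous => s; rewrite in_itv /= => s0t.
  by have [] := dl s s0t.
by rewrite in_itv /= scale0r addr0 subr0 => s0t E; exists s.
Qed.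

(** The mean value theorem, first for the increment of f in the direction b as a
    function along a, then for its derivative in the direction a as a function
    along b. *)
Lemma second_difference f x a b (t : R) : 0 < t ->
  (forall s r : R, 0 <= s <= t -> 0 <= r <= t ->
     differentiable f (x + s *: a + r *: b) /\
     differentiable ('D_a f) (x + s *: a + r *: b)) ->
  exists s r : R, [/\ 0 <= s <= t, 0 <= r <= t &
    f (x + t *: a + t *: b) - f (x + t *: a) - (f (x + t *: b) - f x)
    = 'D_b ('D_a f) (x + s *: a + r *: b) * t * t].
Proof.
move=> t0 df.
have tt : 0 <= t <= t by rewrite ltW /=.
have t00 : 0 <= (0 : R) <= t by rewrite lexx ltW.
pose g y := f (y + t *: b) - f y.
have dtrans y : differentiable f (y + t *: b) ->
    differentiable (fun y => f (y + t *: b)) y.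
  move=> dfy; apply: (@differentiable_comp _ _ _ _ (fun y => y + t *: b) f) => //.
have dtransE y : 'D_a (fun y => f (y + t *: b)) y = 'D_a f (y + t *: b).
  rewrite /derive; set F := fun h => _; set G := fun h => _.
  by suff -> : F = G by []; apply/funext => h; rewrite /F /G /= addrA.
have dg s : 0 <= s <= t -> differentiable g (x + s *: a).
  move=> st; apply: differentiableB.
    by apply: dtrans; exact: (df s t st tt).1.
  by have := (df s 0 st t00).1; rewrite scale0r addr0.
have [s st gE] := mean_value_line t0 dg.
have dDf r : 0 <= r <= t -> differentiable ('D_a f) (x + s *: a + r *: b).
  by move=> rt; exact: (df s r st rt).2.
have [r rt rE] := mean_value_line t0 dDf.
exists s, r; split => //; rewrite -/(g _) in gE *.
rewrite -[f (x + t *: b) - f x]/(g x) -[_ - _ - g x]/(g (x + t *: a) - g x) gE -rE.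
congr (_ * _); rewrite deriveB ?dtransE //.
  by apply/diff_derivable/dtrans; exact: (df s t st tt).1.
by apply: diff_derivable; have := (df s 0 st t00).1; rewrite scale0r addr0.
Qed.

(** The same second difference over a small square is t^2 times either mixed
    derivative at some point of the square; both are continuous at x. *)
Lemma derive_comm A f x a b : open A -> smooth_on A f -> A x ->
  'D_a ('D_b f) x = 'D_b ('D_a f) x.
Proof.
move=> oA sf Ax.
have cont c c' : {for x, continuous ('D_c ('D_c' f))}.
  apply/differentiable_continuous/(smooth_diff _ Ax).
  by do 2![apply: smooth_derive].
apply/eqP; rewrite -subr_eq0 -normr_le0; apply/ler_addgt0Pl => e e0; rewrite addr0.
have e2 : 0 < e / 2 by rewrite divr_gt0.
have /cvgrPdist_lt/(_ _ e2) Hab := cont a b.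
have /cvgrPdist_lt/(_ _ e2) Hba := cont b a.
have /nbhs_ballP[d /= d0 Hd] : nbhs x [set y | [/\ A y,
    `|'D_a ('D_b f) x - 'D_a ('D_b f) y| < e / 2 &
    `|'D_b ('D_a f) x - 'D_b ('D_a f) y| < e / 2]].
  have HA : nbhs x A by exact: open_nbhs_nbhs.
  by apply: filterS3 HA Hab Hba => y Ay Hy1 Hy2; exact: And3 Ay Hy1 Hy2.
(* t is so small that the square spanned by t a and t b lies in the ball *)
pose t := d / 2 / (`|a| + `|b| + 1).
have n0 : 0 < `|a| + `|b| + 1 by rewrite ltr_wpDl // addr_ge0.
have t0 : 0 < t by rewrite !divr_gt0.
have sq s r : 0 <= s <= t -> 0 <= r <= t -> ball x d (x + s *: a + r *: b).
  move=> /andP[s0 st] /andP[r0 rt].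
  rewrite -ball_normE /= -addrA opprD addrA subrr sub0r normrN.
  apply: (le_lt_trans (ler_normD _ _)); rewrite !normrZ !ger0_norm //.
  apply: (@le_lt_trans _ _ (t * `|a| + t * `|b|)).
    by apply: lerD; apply: ler_wpM2r.
  apply: (@le_lt_trans _ _ (t * (`|a| + `|b| + 1))).
    by rewrite mulrDr mulr1 mulrDr lerDl ltW.
  by rewrite /t divfK ?gt_eqF // ltr_pdivrMr // ltr_pMr // ltr1n.
have dsq c s r : 0 <= s <= t -> 0 <= r <= t ->
    differentiable f (x + s *: a + r *: b) /\
    differentiable ('D_c f) (x + s *: a + r *: b).
  move=> st rt; have [Ay _ _] := Hd _ (sq _ _ st rt).
  by split; apply: (smooth_diff _ Ay) => //; exact: smooth_derive.
have [s [r [st rt E]]] := second_difference t0 (dsq a).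
have [|r' [s' [rt' st' E']]] := @second_difference f x b a t t0.
  by move=> r' s' rt' st'; rewrite addrAC; exact: dsq.
have [_ _ N1] := Hd _ (sq _ _ st rt).
have [_ N2 _] := Hd _ (sq _ _ st' rt').
rewrite [x + r' *: b + _]addrAC in E'.
have EE : 'D_b ('D_a f) (x + s *: a + r *: b)
        = 'D_a ('D_b f) (x + s' *: a + r' *: b).
  do 2![apply: (mulIf (lt0r_neq0 t0))].
  have swap (p q p' q' : R) : p - q - (p' - q') = p - p' - (q - q') by ring.
  by rewrite -E -E' [x + t *: b + _]addrAC swap.
rewrite EE distrC in N1; apply: ltW; rewrite [ltRHS]splitr.
by apply: le_lt_trans (ltrD N2 N1); exact: ler_distD.
Qed.

End Smooth.

Section SmoothComp.
Variables (R : realType) (V W : normedModType R) (L : {linear V -> W}).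
Hypothesis L_cont : continuous L.

(** An equality of functions, at all points and with no differentiability
    assumption: the difference quotients coincide. *)
Lemma derive_comp_linear (f : W -> R) w :
  'D_w (f \o L) = ('D_(L w) f) \o L.
Proof.
apply/funext => x /=; rewrite /derive; set F := fun h => _; set G := fun h => _.
by suff -> : F = G by []; apply/funext => h; rewrite /F /G /= linearP.
Qed.

Lemma smooth_comp_linear (A : set V) (B : set W) (f : W -> R) :
  (forall x, A x -> B (L x)) -> smooth_on B f -> smooth_on A (f \o L).
Proof.
move=> AB sf s x Ax.
have -> : foldr (fun w g => 'D_w g) (f \o L) s
    = foldr (fun w g => 'D_w g) f (map L s) \o L.
  by elim: s => //= w s ->; rewrite derive_comp_linear.
apply: differentiable_comp; first exact: linear_differentiable.
by apply: sf; exact: AB.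
Qed.

End SmoothComp.

(** * Differential functions on jets *)

Section MatrixMaps.
Variable R : realType.

Lemma mxsub_continuous m n p q (f : 'I_p -> 'I_m) (g : 'I_q -> 'I_n) :
  continuous (mxsub f g : 'M[R]_(m, n) -> 'M[R]_(p, q)).
Proof.
move=> M S /nbhs_ballP[e e0 eS]; apply/nbhs_ballP; exists e => //= M' MM'.
apply: eS; move: MM'; rewrite -!ball_normE /= => MM'.
apply: le_lt_trans MM'; rewrite -linearB [leLHS]mx_normrE.
apply: bigmax_le => //= ij _; rewrite mxE [leRHS]mx_normrE.
exact: (le_bigmax _ (fun kl => `|(M - M') kl.1 kl.2|) (f ij.1, g ij.2)).
Qed.

Lemma derive_coord m n (i : 'I_m) (j : 'I_n) (w M : 'M[R]_(m, n)) :
  'D_w (fun M : 'M[R]_(m, n) => M i j) M = w i j.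
Proof.
rewrite /derive; apply/lim_near_cst => //.
near=> h; rewrite /= !mxE addrK -mulr_algl /= mulrA.
have h0 : h != 0 by near: h; exact: nbhs_dnbhs_neq.
by rewrite [h^-1%:A]mulr1 mulVf // mul1r.
Unshelve. all: by end_near. Qed.

Lemma smooth_coord m n (A : set 'M[R]_(m, n)) (i : 'I_m) (j : 'I_n) :
  smooth_on A (fun M : 'M[R]_(m, n) => M i j).
Proof.
apply/smooth_uptoP => -[|k]; split => //; try by move=> M _; exact: differentiable_coord.
move=> w; have -> : 'D_w (fun M : 'M[R]_(m, n) => M i j) = cst (w i j).
  by apply/funext => M; rewrite derive_coord.
exact: smooth_upto_cst.
Qed.

End MatrixMaps.

Section Representation.
Variables (R : realType) (N : nat) (U : set 'rV[R]_N).
Hypothesis Uo : open U.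
Implicit Types (u : jet R N) (f g : jfun R N) (k l n : nat) (i j : 'I_N).

(** The jets of order n whose values of the fields lie in U. *)
Definition slab n := [set M : 'M[R]_(n.+1, N) | U (row ord0 M)].
Arguments slab : clear implicits.

Lemma row_mxsub n (M : 'M[R]_(n.+1, N)) :
  row ord0 M = mxsub (fun=> ord0) id M :> 'rV_N.
Proof. by apply/rowP => j; rewrite !mxE. Qed.

Lemma slab_open n : open (slab n).
Proof.
rewrite (_ : slab n = mxsub (fun _ : 'I_1 => ord0) id @^-1` U).
  apply: open_comp => // M _; exact: mxsub_continuous.
by apply/seteqP; split => M; rewrite /slab /= row_mxsub.
Qed.

Lemma row_trunc n u : row ord0 (trunc n u) = u 0%N.
Proof. by apply/rowP => j; rewrite !mxE. Qed.

Lemma trunc_slab n u : U (u 0%N) -> slab n (trunc n u).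
Proof. by rewrite /slab /= row_trunc. Qed.

Definition represents n (phi : 'M[R]_(n.+1, N) -> R) f :=
  smooth_on (slab n) phi /\ eq_over U f (fun u => phi (trunc n u)).

Lemma represents_diff n (phi : 'M[R]_(n.+1, N) -> R) f :
  represents phi f -> diff_fun U f.
Proof. by exists n, phi. Qed.

Lemma represents_raise n m (phi : 'M[R]_(n.+1, N) -> R) f : (n <= m)%N ->
  represents phi f -> exists psi : 'M[R]_(m.+1, N) -> R, represents psi f.
Proof.
move=> nm [sphi fphi].
have nm1 : (n.+1 <= m.+1)%N by [].
pose L : {linear 'M[R]_(m.+1, N) -> 'M[R]_(n.+1, N)} := mxsub (widen_ord nm1) id.
exists (phi \o L); split.
  apply: (@smooth_comp_linear _ _ _ L _ (slab m) (slab n)) => //.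
    exact: mxsub_continuous.
  move=> M; rewrite /slab /=; congr U; apply/rowP => j; rewrite !mxE.
  by congr (M _ _); apply: val_inj.
move=> u Uu; rewrite fphi //=; congr phi; apply/matrixP => k j.
by rewrite !mxE.
Qed.

Lemma represents_common f g : diff_fun U f -> diff_fun U g ->
  exists n (phi psi : 'M[R]_(n.+1, N) -> R), represents phi f /\ represents psi g.
Proof.
move=> [n [phi rf]] [m [psi rg]]; exists (maxn n m).
have [phi' rf'] := represents_raise (leq_maxl n m) rf.
have [psi' rg'] := represents_raise (leq_maxr n m) rg.
by exists phi', psi'.
Qed.

Lemma representsD n (phi psi : 'M[R]_(n.+1, N) -> R) f g :
  represents phi f -> represents psi g ->
  represents (phi + psi) (fun u => f u + g u).
Proof.
move=> [sf fE] [sg gE]; split; first by apply: smoothD => //; exact: slab_open.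
by move=> u Uu; rewrite fE // gE.
Qed.

Lemma representsM n (phi psi : 'M[R]_(n.+1, N) -> R) f g :
  represents phi f -> represents psi g ->
  represents (phi * psi) (fun u => f u * g u).
Proof.
move=> [sf fE] [sg gE]; split; first by apply: smoothM => //; exact: slab_open.
by move=> u Uu; rewrite fE // gE.
Qed.

Lemma diff_fun_eq f g : eq_over U f g -> diff_fun U g -> diff_fun U f.
Proof.
by move=> fg [n [phi [sg gE]]]; exists n, phi; split=> // u Uu; rewrite fg // gE.
Qed.

Lemma diff_funD f g : diff_fun U f -> diff_fun U g ->
  diff_fun U (fun u => f u + g u).
Proof.
move=> df dg; have [n [phi [psi [rf rg]]]] := represents_common df dg.
exact: represents_diff (representsD rf rg).
Qed.

Lemma diff_funM f g : diff_fun U f -> diff_fun U g ->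
  diff_fun U (fun u => f u * g u).
Proof.
move=> df dg; have [n [phi [psi [rf rg]]]] := represents_common df dg.
exact: represents_diff (representsM rf rg).
Qed.

Lemma diff_fun_cst (c : R) : diff_fun U (fun=> c).
Proof. by exists 0%N, (cst c); split => //; exact: smooth_cst. Qed.

Lemma diff_fun0 : diff_fun U (fun=> 0). Proof. exact: diff_fun_cst. Qed.

Lemma diff_funN f : diff_fun U f -> diff_fun U (fun u => - f u).
Proof.
move=> df; apply: (@diff_fun_eq _ (fun u => (-1) * f u)).
  by move=> u _; rewrite mulN1r.
by apply: diff_funM => //; exact: diff_fun_cst.
Qed.

Lemma coord_represents k i :
  represents (fun M : 'M[R]_(k.+1, N) => M ord_max i) (fun u => u k 0 i).
Proof. by split; [exact: smooth_coord|move=> u _; rewrite mxE]. Qed.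

Lemma diff_fun_base (h : 'rV[R]_N -> R) :
  smooth_on U h -> diff_fun U (fun u => h (u 0%N)).
Proof.
move=> sh.
pose L : {linear 'M[R]_(1, N) -> 'rV[R]_N} := mxsub (fun _ : 'I_1 => ord0) id.
exists 0%N, (h \o L); split; last by move=> u _; rewrite /= -row_mxsub row_trunc.
apply: (@smooth_comp_linear _ _ _ L _ _ U) => //; first exact: mxsub_continuous.
Qed.

Definition jet_shift k i u (t : R) : jet R N :=
  fun l => u l + (if l == k then t *: delta_mx 0 i else 0).

(** Partial derivatives at a jet over U only see values over U. *)
Lemma near_jet_shift k i u : U (u 0%N) -> \forall t \near (0 : R), U (jet_shift k i u t 0%N).
Proof.
move=> Uu; rewrite /jet_shift; case: eqP => _; last first.
  by near=> t; rewrite addr0.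
pose e : 'rV[R]_N := delta_mx 0 i.
have c : u 0%N + t *: e @[t --> (0 : R)] --> u 0%N + 0 *: e.
  by apply: cvgD; [exact: cvg_cst|exact: scalel_continuous].
apply: (c U); apply: open_nbhs_nbhs; split => //.
by rewrite scale0r addr0.
Unshelve. all: by end_near. Qed.

Lemma jpd_eq f g k i : eq_over U f g -> eq_over U (jpd k i f) (jpd k i g).
Proof.
move=> fg u Uu; rewrite /jpd !derive1E; apply: near_eq_derive.
by apply: filterS (near_jet_shift k i Uu) => t; exact: fg.
Qed.

(** The direction of the k-th derivative of v^i among jets of order n, zero for
    k > n; so partial derivatives of every order are directional derivatives of
    the representing function. *)
Definition jet_dir n k i : 'M[R]_(n.+1, N) :=
  \matrix_(l, j) ((l == k :> nat) && (j == i))%:R.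

Lemma trunc_shift n k i u t :
  trunc n (jet_shift k i u t) = t *: jet_dir n k i + trunc n u.
Proof.
apply/matrixP => l j; rewrite !mxE addrC; congr (_ + _).
by case: eqP => _; rewrite ?mxE // mulr0.
Qed.

Lemma jet_dir_gt n k i : (n < k)%N -> jet_dir n k i = 0.
Proof.
move=> nk; apply/matrixP => l j; rewrite !mxE; case: eqP => // lk.
by move: (ltn_ord l); rewrite lk ltnS leqNgt nk.
Qed.

Lemma jpd_derive n (phi : 'M[R]_(n.+1, N) -> R) f k i : represents phi f ->
  eq_over U (jpd k i f) (fun u => 'D_(jet_dir n k i) phi (trunc n u)).
Proof.
move=> [_ fE] u Uu; rewrite (jpd_eq k i fE Uu) /jpd derive1E /derive.
set F := fun h => _; set G := fun h => _.
suff -> : F = G by [].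
apply/funext => t; rewrite /F /G /= addr0 [t *: 1]mulr1.
rewrite -!/(jet_shift k i u _) !trunc_shift scale0r add0r.
by [].
Qed.

Lemma represents_jpd n (phi : 'M[R]_(n.+1, N) -> R) f k i : represents phi f ->
  represents ('D_(jet_dir n k i) phi) (jpd k i f).
Proof.
by move=> rf; split; [exact: smooth_derive rf.1|exact: jpd_derive].
Qed.

Lemma diff_fun_jpd f k i : diff_fun U f -> diff_fun U (jpd k i f).
Proof. by move=> [n [phi rf]]; exact: represents_diff (represents_jpd k i rf). Qed.

Lemma jpd_gt n (phi : 'M[R]_(n.+1, N) -> R) f k i : (n < k)%N ->
  represents phi f -> eq_over U (jpd k i f) (fun=> 0).
Proof. by move=> nk rf u Uu; rewrite (jpd_derive k i rf Uu) jet_dir_gt // derive0. Qed.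

Lemma represents_differentiable n (phi : 'M[R]_(n.+1, N) -> R) f u :
  represents phi f -> U (u 0%N) -> differentiable phi (trunc n u).
Proof. by move=> rf Uu; apply: smooth_diff rf.1 _; exact: trunc_slab. Qed.

Lemma jpdD f g k i : diff_fun U f -> diff_fun U g ->
  eq_over U (jpd k i (fun u => f u + g u)) (fun u => jpd k i f u + jpd k i g u).
Proof.
move=> df dg u Uu; have [n [phi [psi [rf rg]]]] := represents_common df dg.
rewrite (jpd_derive k i (representsD rf rg) Uu) (jpd_derive k i rf Uu).
rewrite (jpd_derive k i rg Uu) deriveD //; apply: diff_derivable.
  exact: represents_differentiable rf Uu.
exact: represents_differentiable rg Uu.
Qed.

Lemma jpdM f g k i : diff_fun U f -> diff_fun U g ->
  eq_over U (jpd k i (fun u => f u * g u))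
    (fun u => jpd k i f u * g u + f u * jpd k i g u).
Proof.
move=> df dg u Uu; have [n [phi [psi [rf rg]]]] := represents_common df dg.
rewrite (jpd_derive k i (representsM rf rg) Uu) (jpd_derive k i rf Uu).
rewrite (jpd_derive k i rg Uu) deriveM; last 2 first.
- exact/diff_derivable/(represents_differentiable rf Uu).
- exact/diff_derivable/(represents_differentiable rg Uu).
rewrite rf.2 // rg.2 //.
by rewrite addrC; congr (_ + _); rewrite mulrC.
Qed.

Lemma jpdC f k i l j : diff_fun U f ->
  eq_over U (jpd k i (jpd l j f)) (jpd l j (jpd k i f)).
Proof.
move=> [n [phi rf]] u Uu.
rewrite (jpd_derive k i (represents_jpd l j rf) Uu).
rewrite (jpd_derive l j (represents_jpd k i rf) Uu).
apply: (derive_comm _ _ (@slab_open n)); first exact: rf.1.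
exact: trunc_slab.
Qed.

Lemma jpd_coord k i l j :
  eq_over U (jpd k i (fun u => u l 0 j)) (fun=> ((k == l) && (i == j))%:R).
Proof.
move=> u Uu; rewrite (jpd_derive k i (coord_represents l j) Uu) derive_coord.
by rewrite /= mxE /= eq_sym [j == i]eq_sym.
Qed.

Lemma jpd_base (h : 'rV[R]_N -> R) k i :
  eq_over U (jpd k i (fun u => h (u 0%N)))
            (fun u => if k == 0%N then pd i h (u 0%N) else 0).
Proof.
move=> u _; rewrite /jpd derive1E; case: k => [|k] /=; last first.
  by under eq_fun do rewrite addr0; exact: derive_cst.
rewrite /pd /derive; set F := fun h => _; set G := fun h => _.
suff -> : F = G by [].
apply/funext => t; rewrite /F /G /= addr0 [t *: 1]mulr1 scale0r addr0.
by rewrite [u 0%N + _]addrC.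
Qed.

Lemma fsum_nat n (F : nat -> R) : (forall k, (n <= k)%N -> F k = 0) ->
  \sum_(k \in [set: nat]) F k = \sum_(k < n) F k.
Proof.
move=> F0; rewrite fsbig_ord; apply/esym/fsbig_widen => // k [_ /= /negP].
by rewrite -leqNgt; exact: F0.
Qed.

Lemma Dx_eq f g : eq_over U f g -> eq_over U (Dx f) (Dx g).
Proof.
move=> fg u Uu; apply: eq_fsbigr => k _; apply: eq_bigr => i _.
by rewrite (jpd_eq k i fg).
Qed.

Lemma iter_Dx_eq n f g : eq_over U f g ->
  eq_over U (iter n (@Dx R N) f) (iter n (@Dx R N) g).
Proof. by move=> fg; elim: n => //= n IH; exact: Dx_eq. Qed.

Lemma vard_eq f g i : eq_over U f g -> eq_over U (vard f i) (vard g i).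
Proof.
move=> fg u Uu; apply: eq_fsbigr => k _; congr (_ * _).
by apply: iter_Dx_eq Uu; exact: jpd_eq.
Qed.

End Representation.

(** * The jet algebra of differential functions *)

(** Vanishing off U makes equality over U the equality of the type. *)
Record dfun (R : realType) (N : nat) (U : set 'rV[R]_N) (Uo : open U) := Dfun {
  dfun_val :> jet R N -> R;
  dfun_diff : diff_fun U dfun_val;
  dfun_out : forall u : jet R N, ~ U (u 0%N) -> dfun_val u = 0
}.

Arguments dfun_val : simpl never.

Section DfunRing.
Variables (R : realType) (N : nat) (U : set 'rV[R]_N) (Uo : open U).
Local Notation dfun := (dfun Uo).
Implicit Types (a b c : dfun) (u : jet R N).

Lemma dfun_eq a b : eq_over U a b -> a = b.
Proof.
case: a b => [f df f0] [g dg g0] /= fg.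
have E : f = g.
  by apply/funext => u; have [/fg//|nU] := pselect (U (u 0%N)); rewrite f0 // g0.
by move: dg g0 {fg}; rewrite -E => dg g0; congr Dfun; exact: Prop_irrelevance.
Qed.

(** Opaque, like [dfun_pd_sig]: a differential function is only known by its
    values over U, and comparing two of them must not unfold limits. *)
Lemma mk_dfun_sig (f : jfun R N) : diff_fun U f -> {a : dfun | eq_over U a f}.
Proof.
move=> df; pose f0 u := if pselect (U (u 0%N)) then f u else 0.
have f0E : eq_over U f0 f by move=> u Uu; rewrite /f0; case: pselect.
have f0_out u : ~ U (u 0%N) -> f0 u = 0 by rewrite /f0; case: pselect.
by exists (Dfun Uo (diff_fun_eq f0E df) f0_out).
Qed.

Definition mk_dfun (f : jfun R N) (df : diff_fun U f) : dfun := sval (mk_dfun_sig df).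

Lemma mk_dfunE f (df : diff_fun U f) : eq_over U (mk_dfun df) f.
Proof. exact: svalP (mk_dfun_sig df). Qed.

Definition dfun_add a b := mk_dfun (diff_funD Uo (dfun_diff a) (dfun_diff b)).
Definition dfun_opp a := mk_dfun (diff_funN Uo (dfun_diff a)).
Definition dfun_zero := mk_dfun (diff_fun0 U).
Definition dfun_one := mk_dfun (diff_fun_cst U 1).
Definition dfun_mul a b := mk_dfun (diff_funM Uo (dfun_diff a) (dfun_diff b)).

HB.instance Definition _ := gen_eqMixin dfun.
HB.instance Definition _ := gen_choiceMixin dfun.

Fact dfun_addA : associative dfun_add.
Proof. by move=> a b c; apply: dfun_eq => u Uu; rewrite !mk_dfunE // addrA. Qed.
Fact dfun_addC : commutative dfun_add.
Proof. by move=> a b; apply: dfun_eq => u Uu; rewrite !mk_dfunE // addrC. Qed.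
Fact dfun_add0 : left_id dfun_zero dfun_add.
Proof. by move=> a; apply: dfun_eq => u Uu; rewrite !mk_dfunE // add0r. Qed.
Fact dfun_addN : left_inverse dfun_zero dfun_opp dfun_add.
Proof. by move=> a; apply: dfun_eq => u Uu; rewrite !mk_dfunE // addNr. Qed.
HB.instance Definition _ :=
  GRing.isZmodule.Build dfun dfun_addA dfun_addC dfun_add0 dfun_addN.

Fact dfun_mulA : associative dfun_mul.
Proof. by move=> a b c; apply: dfun_eq => u Uu; rewrite !mk_dfunE // mulrA. Qed.
Fact dfun_mulC : commutative dfun_mul.
Proof. by move=> a b; apply: dfun_eq => u Uu; rewrite !mk_dfunE // mulrC. Qed.
Fact dfun_mul1 : left_id dfun_one dfun_mul.
Proof. by move=> a; apply: dfun_eq => u Uu; rewrite !mk_dfunE // mul1r. Qed.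
Fact dfun_mulD : left_distributive dfun_mul dfun_add.
Proof. by move=> a b c; apply: dfun_eq => u Uu; rewrite !mk_dfunE // mulrDl. Qed.
HB.instance Definition _ :=
  GRing.Zmodule_isComPzRing.Build dfun dfun_mulA dfun_mulC dfun_mul1 dfun_mulD.

Lemma dfunD a b u : U (u 0%N) -> (a + b : dfun) u = a u + b u.
Proof. exact: mk_dfunE. Qed.
Lemma dfunN a u : U (u 0%N) -> (- a : dfun) u = - a u.
Proof. exact: mk_dfunE. Qed.
Lemma dfunB a b u : U (u 0%N) -> (a - b : dfun) u = a u - b u.
Proof. by move=> Uu; rewrite dfunD // dfunN. Qed.
Lemma dfun0 u : U (u 0%N) -> (0 : dfun) u = 0.
Proof. exact: mk_dfunE. Qed.
Lemma dfun1 u : U (u 0%N) -> (1 : dfun) u = 1.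
Proof. exact: mk_dfunE. Qed.
Lemma dfunM a b u : U (u 0%N) -> (a * b : dfun) u = a u * b u.
Proof. exact: mk_dfunE. Qed.
Lemma dfun_sum (I : Type) (r : seq I) (P : pred I) (F : I -> dfun) u : U (u 0%N) ->
  (\sum_(i <- r | P i) F i : dfun) u = \sum_(i <- r | P i) F i u.
Proof.
move=> Uu; apply: (big_morph (fun a : dfun => a u)) => [a b|]; last exact: dfun0.
exact: dfunD.
Qed.
Lemma dfun_nat n u : U (u 0%N) -> (n%:R : dfun) u = n%:R.
Proof.
by move=> Uu; elim: n => [|n IH]; rewrite ?dfun0 // -!natr1 dfunD // IH dfun1.
Qed.
Lemma dfun_sign n a u : U (u 0%N) -> ((-1) ^+ n * a : dfun) u = (-1) ^+ n * a u.
Proof.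
move=> Uu; elim: n => [|n IH]; first by rewrite !expr0 !mul1r.
by rewrite !exprS -!mulrA !mulN1r dfunN // IH.
Qed.

Lemma dfun_pd_sig k i a : {b : dfun | eq_over U b (jpd k i a)}.
Proof. by apply: mk_dfun_sig; exact: diff_fun_jpd (dfun_diff a). Qed.

Definition dfun_pd k i a : dfun := sval (dfun_pd_sig k i a).

Lemma dfun_pdE k i a : eq_over U (dfun_pd k i a) (jpd k i a).
Proof. exact: svalP (dfun_pd_sig k i a). Qed.

Lemma dfun_order_subproof a :
  {n | exists phi : 'M[R]_(n.+1, N) -> R, represents U phi a}.
Proof. by apply: cid; case: (dfun_diff a) => n [phi rf]; exists n, phi. Qed.

Definition dfun_order a : nat := (sval (dfun_order_subproof a)).+1.

Definition dfun_coord k i : dfun := mk_dfun (represents_diff (coord_represents U k i)).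

Lemma dfun_coordE k i : eq_over U (dfun_coord k i) (fun u => u k 0 i).
Proof. exact: mk_dfunE. Qed.

Fact dfun_pdD k i : {morph dfun_pd k i : a b / a + b}.
Proof.
move=> a b; apply: dfun_eq => u Uu; rewrite dfunD // !dfun_pdE //.
rewrite -(jpdD Uo k i (dfun_diff a) (dfun_diff b) Uu).
by apply: (jpd_eq Uo k i _ Uu) => w Uw; exact: dfunD.
Qed.

Fact dfun_pdM k i a b : dfun_pd k i (a * b) = dfun_pd k i a * b + a * dfun_pd k i b.
Proof.
apply: dfun_eq => u Uu; rewrite dfunD // !dfunM // !dfun_pdE //.
rewrite -(jpdM Uo k i (dfun_diff a) (dfun_diff b) Uu).
by apply: (jpd_eq Uo k i _ Uu) => w Uw; exact: dfunM.
Qed.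

Fact dfun_pdC k i l j a : dfun_pd k i (dfun_pd l j a) = dfun_pd l j (dfun_pd k i a).
Proof.
have E k' i' l' j' u : U (u 0%N) ->
    dfun_pd k' i' (dfun_pd l' j' a) u = jpd k' i' (jpd l' j' a) u.
  move=> Uu; rewrite dfun_pdE //.
  exact: (jpd_eq Uo k' i' (dfun_pdE l' j' a) Uu).
apply: dfun_eq => u Uu.
apply: etrans (E k i l j u Uu) _.
apply: etrans (esym (E l j k i u Uu)).
exact: (jpdC Uo k i l j (dfun_diff a) Uu).
Qed.

Fact dfun_pd_order k i a : (dfun_order a <= k)%N -> dfun_pd k i a = 0.
Proof.
rewrite /dfun_order; case: dfun_order_subproof => n [phi rf] /= nk.
by apply: dfun_eq => u Uu; rewrite dfun0 // dfun_pdE // (jpd_gt Uo i nk rf Uu).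
Qed.

Fact dfun_pd_coord k i l j :
  dfun_pd k i (dfun_coord l j) = ((k == l) && (i == j))%:R.
Proof.
apply: dfun_eq => u Uu; rewrite dfun_nat // dfun_pdE //.
by rewrite (jpd_eq Uo k i (dfun_coordE l j) Uu) (jpd_coord Uo k i l j Uu).
Qed.

Definition dfun_jet : jet_algebra N :=
  @JetAlgebra N dfun dfun_pd dfun_order dfun_coord
    dfun_pdD dfun_pdM dfun_pdC dfun_pd_order dfun_pd_coord.

Local Notation A := dfun_jet.

Lemma dx_dfun (a : A) : eq_over U (Dx (a : dfun)) (dx a : dfun).
Proof.
move=> u Uu; rewrite /dx /vfield dfun_sum //.
rewrite /Dx (fsum_nat (n := dfun_order a)) => [|k ak]; last first.
  apply: big1 => i _.
  have := dfun_pd_order i ak; move/(congr1 (fun b : dfun => b u)).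
  by rewrite dfun0 // dfun_pdE // => ->; rewrite mulr0.
apply: eq_bigr => k _; rewrite dfun_sum //; apply: eq_bigr => i _.
by rewrite dfunM // dfun_coordE // dfun_pdE.
Qed.

Lemma iter_dx_dfun n (a : A) :
  eq_over U (iter n (@Dx R N) (a : dfun)) (iter n (@dx N A) a : dfun).
Proof.
elim: n => [|n IH] u Uu //=.
by rewrite (Dx_eq Uo IH Uu); exact: dx_dfun.
Qed.

Lemma euler_dfun (a : A) i : eq_over U (vard (a : dfun) i) (euler i a : dfun).
Proof.
move=> u Uu; rewrite /euler dfun_sum //.
have H k : iter k (@Dx R N) (jpd k i a) u = (iter k (@dx N A) (jet_pd k i a) : dfun) u.
  rewrite -(iter_dx_dfun k _ Uu); apply: (iter_Dx_eq Uo) Uu => w Uw.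
  by rewrite dfun_pdE.
rewrite /vard (fsum_nat (n := dfun_order a)) => [|k ak]; last first.
  by rewrite H vanishes_order // iter_dx0 dfun0 // mulr0.
by apply: eq_bigr => k _; rewrite H dfun_sign.
Qed.

Lemma eq_functional_dfun (f g : jfun R N) (a b : A) :
  eq_over U f (a : dfun) -> eq_over U g (b : dfun) ->
  eq_functional U f g <-> eq_int a b.
Proof.
move=> fa gb; split=> [[F [dF FE]]|[F FE]].
  exists (mk_dfun dF); apply: dfun_eq => u Uu.
  rewrite -(dx_dfun _ Uu) (Dx_eq Uo (mk_dfunE dF) Uu) -FE // dfunB // fa // gb //.
exists F; split; first exact: dfun_diff.
move=> u Uu; rewrite (dx_dfun _ Uu) -FE dfunB // fa // gb //.
Qed.

(** Functions of the undifferentiated fields. *)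
Definition base (h : 'rV[R]_N -> R) (sh : smooth_on U h) : A :=
  mk_dfun (diff_fun_base sh).

Lemma baseE h (sh : smooth_on U h) : eq_over U (base sh : dfun) (fun u => h (u 0%N)).
Proof. exact: mk_dfunE. Qed.

Lemma pd_baseE h (sh : smooth_on U h) k i u : U (u 0%N) ->
  (jet_pd k i (base sh) : dfun) u = if k == 0%N then pd i h (u 0%N) else 0.
Proof.
move=> Uu; rewrite dfun_pdE // (jpd_eq Uo k i (baseE sh) Uu).
exact: (jpd_base h k i Uu).
Qed.

Lemma base_pd h (sh : smooth_on U h) i :
  jet_pd 0 i (base sh) = base (smooth_derive (delta_mx 0 i) sh).
Proof. by apply: dfun_eq => u Uu; rewrite pd_baseE // baseE. Qed.

Lemma base_vanishes h (sh : smooth_on U h) : vanishes_from 1 (base sh).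
Proof.
by move=> [|k] i // _; apply: dfun_eq => u Uu; rewrite pd_baseE // dfun0.
Qed.

Lemma base_pd_vanishes h (sh : smooth_on U h) i : vanishes_from 1 (jet_pd 0 i (base sh)).
Proof. by rewrite base_pd; exact: base_vanishes. Qed.

Lemma const_smooth (c : R) : smooth_on U (cst c).
Proof. exact: smooth_cst. Qed.

Definition const (c : R) : A := base (const_smooth c).

Lemma constE (c : R) u : U (u 0%N) -> (const c : dfun) u = c.
Proof. exact: baseE. Qed.

Lemma const_vanishes (c : R) : vanishes_from 0 (const c).
Proof.
move=> k i _; apply: dfun_eq => u Uu; rewrite pd_baseE // dfun0 //.
by case: ifP => // _; rewrite /pd derive_cst.
Qed.

Lemma const_eq (c : R) (x : A) : (forall u, U (u 0%N) -> (x : dfun) u = c) ->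
  const c = x.
Proof. by move=> xc; apply: dfun_eq => u Uu; rewrite constE // xc. Qed.

Lemma const0 : const 0 = 0.
Proof. by apply: const_eq => u Uu; rewrite dfun0. Qed.

Lemma const1 : const 1 = 1.
Proof. by apply: const_eq => u Uu; rewrite dfun1. Qed.

Lemma constD (c c' : R) : const (c + c') = const c + const c'.
Proof. by apply: const_eq => u Uu; rewrite dfunD // !constE. Qed.

Lemma constM (c c' : R) : const (c * c') = const c * const c'.
Proof. by apply: const_eq => u Uu; rewrite dfunM // !constE. Qed.

End DfunRing.

(** * The pencil of operators *)

Section Pencil.
Variables (R : realType) (N : nat) (U : set 'rV[R]_N) (eta : 'M[R]_N) (K : R).
Variables (h : 'I_N -> 'rV[R]_N -> R) (Dinv : jfun R N -> jfun R N).
Hypothesis Uo : open U.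
Hypothesis eta_sym : eta^T = eta.
Hypothesis h_smooth : forall i, smooth_on U (h i).
Hypothesis Dinv_inverse : formal_inverse U Dinv.
Hypothesis h_eq1 : forall (v : 'rV[R]_N) (i j k l : 'I_N), U v ->
  \sum_(s < N) \sum_(p < N) pd k (pd s (h i)) v * eta s p * pd p (pd l (h j)) v
  = \sum_(s < N) \sum_(p < N) pd k (pd s (h j)) v * eta s p * pd p (pd l (h i)) v.
Hypothesis h_eq2 : forall (v : 'rV[R]_N) (i j k : 'I_N), U v ->
  \sum_(s < N) \sum_(p < N)
    (\sum_(r < N) eta i r * pd r (h s) v
     + \sum_(r < N) eta s r * pd r (h i) v - K * v 0 i * v 0 s)
    * eta j p * pd p (pd s (h k)) v
  = \sum_(s < N) \sum_(p < N)
    (\sum_(r < N) eta j r * pd r (h s) v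
     + \sum_(r < N) eta s r * pd r (h j) v - K * v 0 j * v 0 s)
    * eta i p * pd p (pd s (h k)) v.
Variables a b : R.

Local Notation A := (dfun_jet Uo).
Local Notation val x := (dfun_val (x : dfun Uo)).
Local Notation C := (const Uo).
Implicit Types (i j k l s p q : 'I_N) (u : jet R N).

Lemma etaC i j : eta i j = eta j i.
Proof. by rewrite -[in LHS]eta_sym mxE. Qed.

Definition hfun j : A := base Uo (h_smooth j).
(** Opaque, so that Hessians are only compared through [hess_def]. *)
Lemma hess_sig : {H : 'I_N -> 'I_N -> 'I_N -> A |
  forall s q j, H s q j = jet_pd 0 s (jet_pd 0 q (hfun j))}.
Proof. by exists (fun s q j => jet_pd 0 s (jet_pd 0 q (hfun j))). Qed.

Definition hess : 'I_N -> 'I_N -> 'I_N -> A := sval hess_sig.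

Lemma hess_def s q j : hess s q j = jet_pd 0 s (jet_pd 0 q (hfun j)).
Proof. exact: svalP hess_sig s q j. Qed.
(** Half of b eta, since the metric symmetrizes this matrix. *)
Definition pencil_mx i j : A :=
  C a * (\sum_s C (eta i s) * jet_pd 0 s (hfun j)) + C (b / 2 * eta i j).
Definition pencil_cst : A := C (a * K).

Lemma hessE s q j u : U (u 0%N) -> val (hess s q j) u = pd s (pd q (h j)) (u 0%N).
Proof. by move=> Uu; rewrite hess_def base_pd pd_baseE. Qed.

Lemma hessC s q j : hess s q j = hess q s j.
Proof. by rewrite !hess_def jet_pdC. Qed.

Lemma pd_pdC v s q j : U v -> pd s (pd q (h j)) v = pd q (pd s (h j)) v.
Proof. by move=> Uv; exact: (derive_comm _ _ Uo (h_smooth j) Uv). Qed.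

Lemma pencil_mx_order i j : vanishes_from 1 (pencil_mx i j).
Proof.
have cst1 (c : R) : vanishes_from 1 (C c).
  exact: vanishesW (const_vanishes Uo c).
apply: vanishesD => //; apply: vanishesM => //; apply: vanishes_sum => s.
by apply: vanishesM => //; exact: base_pd_vanishes.
Qed.

Lemma pencil_cst_const : vanishes_from 0 pencil_cst.
Proof. exact: const_vanishes. Qed.

Lemma pd_constM (c : R) (x : A) (k : nat) i : jet_pd k i (C c * x) = C c * jet_pd k i x.
Proof. by rewrite jet_pdM const_vanishes // mul0r add0r. Qed.

Lemma pencil_mx_pd i j l :
  jet_pd 0 l (pencil_mx i j) = C a * \sum_s C (eta i s) * hess l s j.
Proof.
rewrite jet_pdD const_vanishes // addr0 pd_constM jet_pd_sum.
congr (_ * _); apply: eq_bigr => s _.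
by rewrite pd_constM hess_def.
Qed.

Lemma pencil_mxE i j u : U (u 0%N) ->
  val (pencil_mx i j) u
  = a * (\sum_s eta i s * pd s (h j) (u 0%N)) + b / 2 * eta i j.
Proof.
move=> Uu; rewrite dfunD // dfunM // !constE // dfun_sum //.
congr (_ * _ + _); apply: eq_bigr => s _.
by rewrite dfunM // constE // pd_baseE.
Qed.

Lemma pencil_metricE i j u : U (u 0%N) ->
  val (metric_coef pencil_mx pencil_cst i j) u
  = a * metric eta K h i j (u 0%N) + b * eta i j.
Proof.
move=> Uu; rewrite /metric_coef dfunB // dfunD // !dfunM // !pencil_mxE //.
rewrite constE // !dfun_coordE // (etaC j i) /metric.
move: (\sum_s _) (\sum_s _) (eta i j) (u 0%N 0 i) (u 0%N 0 j) => S T e x y.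
by field.
Qed.

Lemma pencil_mx_pdE i j s u : U (u 0%N) ->
  val (jet_pd 0 s (pencil_mx i j)) u
  = a * \sum_q eta i q * pd q (pd s (h j)) (u 0%N).
Proof.
move=> Uu; rewrite pencil_mx_pd dfunM // constE // dfun_sum //; congr (_ * _).
by apply: eq_bigr => q _; rewrite dfunM // constE // hessC hessE.
Qed.

Lemma contractE (e M H : 'I_N -> 'I_N -> R) i l :
  \sum_s (a * M l s + b * e l s) * (a * \sum_q e i q * H q s)
  = a * a * (\sum_s \sum_q M l s * e i q * H q s)
    + a * b * (\sum_s \sum_q e l s * e i q * H q s).
Proof.
rewrite [X in X + _]mulr_sumr [X in _ + X]mulr_sumr -big_split.
apply: eq_bigr => s _ /=; rewrite !mulr_sumr -big_split.
by apply: eq_bigr => q _ /=; ring.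
Qed.

Lemma metricC i j v : metric eta K h i j v = metric eta K h j i v.
Proof. by rewrite /metric [X in X - _]addrC mulrAC. Qed.

Lemma metric_hess v i j k : U v ->
  \sum_s \sum_p metric eta K h i s v * eta j p * pd p (pd s (h k)) v
  = \sum_s \sum_p metric eta K h j s v * eta i p * pd p (pd s (h k)) v.
Proof. exact: h_eq2. Qed.

(** The second condition on h multiplied by a^2, plus ab times an expression
    which is symmetric because the Hessian of h^j is. *)
Lemma pencil_metric_sym i j l :
  \sum_s metric_coef pencil_mx pencil_cst s l * jet_pd 0 s (pencil_mx i j)
  = \sum_s metric_coef pencil_mx pencil_cst s i * jet_pd 0 s (pencil_mx l j).
Proof.
apply: dfun_eq => u Uu.
have E i' l' : val (\sum_s metric_coef pencil_mx pencil_cst s l'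
      * jet_pd 0 s (pencil_mx i' j)) u
    = a * a * (\sum_s \sum_q metric eta K h l' s (u 0%N) * eta i' q
         * pd q (pd s (h j)) (u 0%N))
      + a * b * (\sum_s \sum_q eta l' s * eta i' q * pd q (pd s (h j)) (u 0%N)).
  rewrite -(contractE eta (fun l s => metric eta K h l s (u 0%N))
    (fun q s => pd q (pd s (h j)) (u 0%N))).
  rewrite dfun_sum //; apply: eq_bigr => s _.
  rewrite (dfunM _ _ Uu) (pencil_metricE _ _ Uu) (pencil_mx_pdE _ _ _ Uu).
  by rewrite (metricC s) (etaC s).
rewrite (E i l) (E l i) (metric_hess l i j Uu); congr (_ + _ * _).
rewrite exchange_big; apply: eq_bigr => s _; apply: eq_bigr => q _.
rewrite (pd_pdC s q j Uu); congr (_ * _); exact: mulrC.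
Qed.

Lemma pencil_dx_mx i j :
  dx (pencil_mx i j) = C a * \sum_k \sum_s C (eta i s) * (jet_coord A 1 k * hess k s j).
Proof.
rewrite dx_order0; last exact: pencil_mx_order.
rewrite mulr_sumr; apply: eq_bigr => k _; rewrite pencil_mx_pd mulrCA; congr (_ * _).
by rewrite mulr_sumr; apply: eq_bigr => s _; rewrite mulrCA.
Qed.

Lemma hess_comm q k j l :
  \sum_s \sum_p hess q s j * C (eta s p) * hess p k l
  = \sum_s \sum_p hess q s l * C (eta s p) * hess p k j.
Proof.
apply: dfun_eq => u Uu.
have E j' l' : val (\sum_s \sum_p hess q s j' * C (eta s p) * hess p k l') u
    = \sum_s \sum_p pd q (pd s (h j')) (u 0%N) * eta s p * pd p (pd k (h l')) (u 0%N).
  rewrite (dfun_sum _ _ _ Uu); apply: eq_bigr => s _.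
  rewrite (dfun_sum _ _ _ Uu).
  apply: eq_bigr => p _; rewrite !(dfunM _ _ Uu) (constE _ _ Uu).
  by rewrite (hessE q s j' Uu) (hessE p k l' Uu).
by apply: (etrans (E j l)); apply: (etrans _ (esym (E l j))); exact: h_eq1.
Qed.

(** The first condition on h, contracted with eta and v_x and multiplied by
    a^2. *)
Lemma pencil_hessian_comm i j l :
  \sum_s dx (pencil_mx s l) * jet_pd 0 s (pencil_mx i j)
  = \sum_s dx (pencil_mx s j) * jet_pd 0 s (pencil_mx i l).
Proof.
have E j' l' : \sum_s dx (pencil_mx s l') * jet_pd 0 s (pencil_mx i j')
    = C a * C a * \sum_k \sum_q jet_coord A 1 k * C (eta i q) *
        (\sum_s \sum_p hess q s j' * C (eta s p) * hess p k l').
  rewrite mulr_sumr.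
  under [RHS]eq_bigr => k _ do rewrite mulr_sumr.
  transitivity (\sum_k \sum_q \sum_s C a * C a * (jet_coord A 1 k * C (eta i q) *
        (\sum_p hess q s j' * C (eta s p) * hess p k l'))); last first.
    apply: eq_bigr => k _; apply: eq_bigr => q _.
    by rewrite !mulr_sumr; apply: eq_bigr => s _; rewrite mulrA.
  under [RHS]eq_bigr => k _ do rewrite exchange_big /=.
  rewrite [RHS]exchange_big /=; apply: eq_bigr => s _.
  rewrite pencil_dx_mx pencil_mx_pd mulrACA -mulrA mulr_suml.
  rewrite mulr_sumr mulr_sumr; apply: eq_bigr => k _.
  rewrite mulr_sumr !mulr_sumr; apply: eq_bigr => q _.
  rewrite -!mulrA; congr (_ * (_ * _)).
  rewrite mulr_suml mulr_sumr mulr_sumr; apply: eq_bigr => p _.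
  rewrite (hessC q s) (hessC p k); ring.
rewrite !E; congr (_ * _); apply: eq_bigr => k _; apply: eq_bigr => q _.
by rewrite hess_comm.
Qed.

Lemma connection_sum i j v (y : 'I_N -> R) : U v ->
  \sum_k connection eta K h i j k v * y k
  = \sum_k \sum_s eta i s * (y k * pd k (pd s (h j)) v) - K * y i * v 0 j.
Proof.
move=> Uv.
have -> : K * y i * v 0 j = \sum_k K * (i == k)%:R * v 0 j * y k.
  rewrite (bigD1 i) //= eqxx big1 ?addr0 => [|k]; first by rewrite mulr1 mulrAC.
  by rewrite eq_sym => /negPf ->; rewrite mulr0 !mul0r.
rewrite -sumrB; apply: eq_bigr => k _; rewrite mulrBl; congr (_ - _).
rewrite mulr_suml; apply: eq_bigr => s _; rewrite (pd_pdC s k j Uv).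
by rewrite -mulrA; congr (_ * _); exact: mulrC.
Qed.

Lemma pencil_dx_mxE i j u : U (u 0%N) ->
  val (dx (pencil_mx i j)) u
  = a * \sum_k \sum_s eta i s * (u 1%N 0 k * pd k (pd s (h j)) (u 0%N)).
Proof.
move=> Uu; rewrite pencil_dx_mx (dfunM _ _ Uu) (constE _ _ Uu) (dfun_sum _ _ _ Uu).
congr (_ * _); apply: eq_bigr => k _; rewrite (dfun_sum _ _ _ Uu).
apply: eq_bigr => s _; rewrite (dfunM _ _ Uu) (constE _ _ Uu) (dfunM _ _ Uu).
by rewrite (hessE _ _ _ Uu) (dfun_coordE _ _ _ Uu).
Qed.

(** The correction by v^j x_j turns the term - K delta^i_k v^j of the connection
    into a part of the nonlocal term. *)
Lemma operator_ham_field (xi : 'I_N -> jfun R N) (x : 'I_N -> A) (w : A) :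
  (forall j, eq_over U (xi j) (val (x j))) ->
  eq_over U (Dinv (fun w => \sum_j w 1%N 0 j * xi j w)) (val w) ->
  dx w = pairing (jet_coord A 1) x ->
  let W := w - pairing (jet_coord A 0) x in
  potential x W /\
  forall i, eq_over U (lin_comb a b (P1 Dinv eta K h) (P2 eta) xi i)
    (val (ham_field pencil_mx pencil_cst x W i)).
Proof.
move=> xiE DE dw W.
have pW : potential x W.
  rewrite /potential /W dxB dx_pairing dw opprD addrA.
  have -> : der (jet_coord A 0) = jet_coord A 1.
    by apply/funext => i; exact: dx_coord.
  by rewrite subrr sub0r.
split=> // i u Uu.
set v := u 0%N; set y := u 1%N 0.
pose X j := val (x j) u; pose X' j := val (dx (x j)) u; pose w0 := val w u.
pose S j := \sum_k \sum_s eta i s * (y k * pd k (pd s (h j)) v).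
pose G j := metric eta K h i j v.
have -> : lin_comb a b (P1 Dinv eta K h) (P2 eta) xi i u
    = a * (\sum_j G j * X' j + \sum_j (S j - K * y i * v 0 j) * X j + K * y i * w0)
      + b * \sum_j eta i j * X' j.
  have DxE j : Dx (xi j) u = X' j by rewrite (Dx_eq Uo (xiE j) Uu) dx_dfun.
  congr (a * (_ + _ + _ * _) + b * _).
  - by apply: eq_bigr => j _; rewrite DxE.
  - apply: eq_bigr => j _; rewrite -connection_sum // mulr_suml.
    by apply: eq_bigr => k _; rewrite (xiE j u Uu).
  - exact: DE.
  - by apply: eq_bigr => j _; rewrite DxE.
rewrite (ham_fieldE _ pencil_cst_const i pW) (dfunD _ _ Uu) (dfunD _ _ Uu).
have -> : val (\sum_l metric_coef pencil_mx pencil_cst i l * dx (x l)) u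
    = \sum_l (a * G l + b * eta i l) * X' l.
  rewrite (dfun_sum _ _ _ Uu); apply: eq_bigr => l _.
  by rewrite (dfunM _ _ Uu) (pencil_metricE _ _ Uu).
have -> : val (\sum_l dx (pencil_mx i l) * x l) u = \sum_l a * S l * X l.
  rewrite (dfun_sum _ _ _ Uu); apply: eq_bigr => l _.
  by rewrite (dfunM _ _ Uu) (pencil_dx_mxE _ _ Uu).
have -> : val (pencil_cst * (jet_coord A 1 i * W)) u
    = a * K * (y i * (w0 - \sum_j v 0 j * X j)).
  rewrite (dfunM _ _ Uu) (constE _ _ Uu) (dfunM _ _ Uu) (dfun_coordE _ _ _ Uu).
  rewrite (dfunB _ _ Uu) (dfun_sum _ _ _ Uu).
  congr (_ * (_ * (_ - _))); apply: eq_bigr => j _.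
  by rewrite (dfunM _ _ Uu) (dfun_coordE _ _ _ Uu).
have -> : \sum_j (S j - K * y i * v 0 j) * X j
    = \sum_j S j * X j - K * y i * \sum_j v 0 j * X j.
  by rewrite mulr_sumr -sumrB; apply: eq_bigr => j _; rewrite mulrBl mulrA.
have -> : \sum_l (a * G l + b * eta i l) * X' l
    = a * \sum_l G l * X' l + b * \sum_l eta i l * X' l.
  by rewrite !mulr_sumr -big_split; apply: eq_bigr => l _ /=; ring.
have -> : \sum_l a * S l * X l = a * \sum_l S l * X l.
  by rewrite mulr_sumr; apply: eq_bigr => l _; rewrite mulrA.
move: (\sum_l G l * X' l) (\sum_l S l * X l) (\sum_j v 0 j * X j) => T1 T2 T3.
move: (\sum_l eta i l * X' l) (y i) w0 => T4 y' w'; ring.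
Qed.

Local Notation P := (lin_comb a b (P1 Dinv eta K h) (P2 eta)).
Local Notation E := (@euler N A).
Local Notation ham_field := (ham_field pencil_mx pencil_cst).

(** On a variational derivative the nonlocal term is applied to a total
    derivative, so that the formal inverse yields a differential function. *)
Lemma operator_vard (g : jfun R N) (G : A) : eq_over U g (val G) ->
  exists W, potential (E^~ G) W /\
    forall i, eq_over U (P (vard g) i) (val (ham_field (E^~ G) W i)).
Proof.
move=> gG; have [F FE] := coord_euler G; rewrite subr0 in FE.
have xiE j : eq_over U (vard g j) (val (E j G)).
  by move=> u Uu; rewrite (vard_eq Uo j gG Uu) euler_dfun.
pose f (u : jet R N) := \sum_j u 1%N 0 j * vard g j u.
have fE : eq_over U f (val (\sum_j jet_coord A 1 j * E j G)).
  move=> u Uu; rewrite (dfun_sum _ _ _ Uu); apply: eq_bigr => j _.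
  by rewrite (dfunM _ _ Uu) (dfun_coordE _ _ _ Uu) (xiE j u Uu).
have fF : eq_over U f (Dx (val F)).
  by move=> u Uu; rewrite (fE u Uu) FE dx_dfun.
have [dI DI _] := Dinv_inverse (dfun_diff (F : dfun Uo)) fF.
pose w : A := mk_dfun Uo dI.
have dw : dx w = pairing (jet_coord A 1) (E^~ G).
  apply: dfun_eq => u Uu; rewrite -(dx_dfun _ Uu) (Dx_eq Uo (mk_dfunE Uo dI) Uu).
  by rewrite (DI u Uu) (fE u Uu).
have DE : eq_over U (Dinv f) (val w) by move=> u Uu; rewrite (mk_dfunE Uo dI Uu).
have [pW WE] := operator_ham_field xiE DE dw.
by exists (w - pairing (jet_coord A 0) (E^~ G)).
Qed.

Lemma bracket_pairing (f g : jfun R N) (F : A) (X : 'I_N -> A) :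
  eq_over U f (val F) -> (forall i, eq_over U (P (vard g) i) (val (X i))) ->
  eq_over U (bracket P f g) (val (pairing (E^~ F) X)).
Proof.
move=> fF gX u Uu; rewrite (dfun_sum _ _ _ Uu); apply: eq_bigr => i _.
by rewrite (dfunM _ _ Uu) (vard_eq Uo i fF Uu) (euler_dfun _ _ Uu) (gX i u Uu).
Qed.

(** Two potentials of the same covector may differ by a constant, so that
    independence of the representatives is not immediate on the right: by
    skew-symmetry it follows from the independence on the left. *)
Lemma pencil_hamiltonian : hamiltonian U P.
Proof.
have lift f : diff_fun U f -> exists F : A, eq_over U f (val F).
  by move=> df; exists (mk_dfun Uo df) => u Uu; rewrite mk_dfunE.
have KC := pencil_cst_const.
split.
- move=> f g /lift[F fF] /lift[G gG]; have [W [_ WE]] := operator_vard gG.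
  by apply: diff_fun_eq (bracket_pairing fF WE) _; exact: dfun_diff.
- move=> f f' g g' /lift[F fF] /lift[F' fF'] /lift[G gG] /lift[G' gG'].
  move=> /(eq_functional_dfun fF fF') FF' /(eq_functional_dfun gG gG') GG'.
  have [W [pW WE]] := operator_vard gG; have [W' [pW' WE']] := operator_vard gG'.
  have [Z [pZ _]] := operator_vard fF.
  apply/(eq_functional_dfun (bracket_pairing fF WE) (bracket_pairing fF' WE')).
  have EF : E^~ F' = E^~ F by apply/funext => i; rewrite (euler_int i FF').
  have EG : E^~ G' = E^~ G by apply/funext => i; rewrite (euler_int i GG').
  rewrite EF EG in pW' *.
  apply: (eq_int_trans (ham_field_skew _ KC pZ pW)); apply: eq_int_sym.
  exact: ham_field_skew.
- move=> c f f' g /lift[F fF] /lift[F' fF'] /lift[G gG].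
  have [W [_ WE]] := operator_vard gG.
  have cE : eq_over U (fun u => c * f u + f' u) (val (C c * F + F')).
    by move=> u Uu; rewrite (dfunD _ _ Uu) (dfunM _ _ Uu) (constE _ _ Uu) fF // fF'.
  pose X := ham_field (E^~ G) W.
  have bE : eq_over U (fun u => c * bracket P f g u + bracket P f' g u)
      (val (C c * pairing (E^~ F) X + pairing (E^~ F') X)).
    move=> u Uu; rewrite (dfunD _ _ Uu) (dfunM _ _ Uu) (constE _ _ Uu).
    by rewrite (bracket_pairing fF WE Uu) (bracket_pairing fF' WE Uu).
  apply/(eq_functional_dfun (bracket_pairing cE WE) bE); apply: eq_int_eq.
  rewrite /pairing mulr_sumr -big_split; apply: eq_bigr => i _ /=.
  by rewrite eulerD (euler_constM _ _ (const_vanishes _ _)) mulrDl mulrA.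
- move=> f g /lift[F fF] /lift[G gG].
  have [W [pW WE]] := operator_vard gG; have [Z [pZ ZE]] := operator_vard fF.
  have nE : eq_over U (fun u => - bracket P g f u)
      (val (- pairing (E^~ G) (ham_field (E^~ F) Z))).
    by move=> u Uu; rewrite (dfunN _ Uu) (bracket_pairing gG ZE Uu).
  apply/(eq_functional_dfun (bracket_pairing fF WE) nE); exact: ham_field_skew.
- move=> f g k /lift[F fF] /lift[G gG] /lift[H kH].
  have [Wf [pf fE]] := operator_vard fF; have [Wg [pg gE]] := operator_vard gG.
  have [Wk [pk kE]] := operator_vard kH.
  have fgk := bracket_pairing (bracket_pairing fF gE) kE.
  have gkf := bracket_pairing (bracket_pairing gG kE) fE.
  have kfg := bracket_pairing (bracket_pairing kH fE) gE.
  have zE : eq_over U (fun=> 0) (val (0 : A)) by move=> u Uu; rewrite dfun0.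
  refine ((eq_functional_dfun _ zE).2 (jacobi_identity pencil_mx_order KC
    pencil_metric_sym pencil_hessian_comm pf pg pk)) => u Uu.
  rewrite (dfunD _ _ Uu) (dfunD _ _ Uu).
  exact: (congr2 _ (congr2 _ (fgk u Uu) (gkf u Uu)) (kfg u Uu)).
Qed.

End Pencil.

(** * The bi-Hamiltonian system *)

(** The index i0 provides the empty sum, as zero times a coordinate. *)
Lemma dpoly0_sum (R : realType) (N : nat) (i0 : 'I_N) (F : 'I_N -> jfun R N) :
  (forall i, dpoly0 (F i)) -> dpoly0 (fun u => \sum_i F i u).
Proof.
move=> dF; elim: (index_enum _) => [|i r IH].
  have -> : (fun u => \sum_(i <- [::]) F i u) = (fun u => 0 * u 0%N 0 i0).
    by apply/funext => u; rewrite big_nil mul0r.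
  exact/dpoly0_scale/dpoly0_coord.
have -> : (fun u => \sum_(i <- i :: r) F i u)
    = (fun u => F i u + \sum_(i <- r) F i u).
  by apply/funext => u; rewrite big_cons.
exact: dpoly0_add.
Qed.

Section Flow.
Variables (R : realType) (N : nat) (U : set 'rV[R]_N) (eta : 'M[R]_N) (K : R).
Variables (h : 'I_N -> 'rV[R]_N -> R) (Dinv : jfun R N -> jfun R N).
Hypothesis Uo : open U.
Hypothesis eta_sym : eta^T = eta.
Hypothesis eta_nondeg : eta \in unitmx.
Hypothesis h_smooth : forall i, smooth_on U (h i).
Hypothesis Dinv_inverse : formal_inverse U Dinv.

Local Notation A := (dfun_jet Uo).
Local Notation val x := (dfun_val (x : dfun Uo)).
Local Notation C := (const Uo).
Local Notation v := (@jet_coord N A 0).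
Local Notation D := (@dx N A).
Local Notation theta := (invmx eta).
Local Notation hf := (hfun Uo h_smooth).
Implicit Types (i j k l m s : 'I_N) (u : jet R N).

Lemma thetaC i j : theta i j = theta j i.
Proof. by rewrite -[in LHS]eta_sym -trmx_inv mxE. Qed.

Lemma eta_theta i j : \sum_k eta i k * theta k j = (i == j)%:R.
Proof. by have /matrixP/(_ i j) := mulmxV eta_nondeg; rewrite !mxE. Qed.

(** The covector eta_{jl} v^l, variational derivative of H1. *)
Definition lower j : A := \sum_l C (theta j l) * v l.
Definition quad : A := \sum_j v j * lower j.

Lemma coord_order1 j : vanishes_from 1 (v j).
Proof. by move=> [|k] i // _; rewrite jet_pd_coord. Qed.

Lemma const_order1 (c : R) : vanishes_from 1 (C c).
Proof. exact: vanishesW (const_vanishes Uo c). Qed.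

Lemma lower_order1 j : vanishes_from 1 (lower j).
Proof.
apply: vanishes_sum => l; apply: vanishesM; first exact: const_order1.
exact: coord_order1.
Qed.

Lemma quad_order1 : vanishes_from 1 quad.
Proof.
apply: vanishes_sum => l; apply: vanishesM; first exact: coord_order1.
exact: lower_order1.
Qed.

Lemma sum_deltaE (F : 'I_N -> A) i : \sum_j (i == j)%:R * F j = F i.
Proof.
rewrite (bigD1 i) //= eqxx mul1r big1 ?addr0 // => j.
by rewrite eq_sym => /negPf ->; rewrite mul0r.
Qed.

Lemma pd_lower i j : jet_pd 0 i (lower j) = C (theta j i).
Proof.
rewrite jet_pd_sum -[RHS](sum_deltaE (fun l => C (theta j l)) i).
apply: eq_bigr => l _; rewrite pd_constM jet_pd_coord eqxx /=.
exact: mulrC.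
Qed.

Lemma pd_quad i : jet_pd 0 i quad = lower i + lower i.
Proof.
rewrite jet_pd_sum -{1}[lower i](sum_deltaE lower i) -big_split.
apply: eq_bigr => j _ /=; rewrite jet_pdM jet_pd_coord eqxx /= pd_lower thetaC.
by congr (_ + _); exact: mulrC.
Qed.

Lemma quadE u : U (u 0%N) ->
  val quad u = \sum_j \sum_l theta j l * u 0%N 0 j * u 0%N 0 l.
Proof.
move=> Uu; rewrite (dfun_sum _ _ _ Uu); apply: eq_bigr => j _.
rewrite (dfunM _ _ Uu) (dfun_sum _ _ _ Uu) mulr_sumr; apply: eq_bigr => l _.
by rewrite (dfunM _ _ Uu) (constE _ _ Uu) !(dfun_coordE _ _ _ Uu); ring.
Qed.

Lemma lowerE j u : U (u 0%N) -> val (lower j) u = \sum_l theta j l * u 0%N 0 l.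
Proof.
move=> Uu; rewrite (dfun_sum _ _ _ Uu); apply: eq_bigr => l _.
by rewrite (dfunM _ _ Uu) (constE _ _ Uu) (dfun_coordE _ _ _ Uu).
Qed.

Definition momentum : A := C (1 / 2) * quad.

Lemma halfD (x : A) : C (1 / 2) * (x + x) = x.
Proof.
have h1 : C (1 / 2) + C (1 / 2) = 1 by rewrite -constD -(const1 Uo); congr C; field.
by rewrite mulrDr -mulrDl h1 mul1r.
Qed.

Lemma H1E : eq_over U (H1 eta) (val momentum).
Proof.
by move=> u Uu; rewrite (dfunM _ _ Uu) (constE _ _ Uu) (quadE Uu).
Qed.

Lemma euler_momentum i : euler i momentum = lower i.
Proof.
rewrite euler_order0; last first.
  by apply: vanishesM; [exact: const_order1|exact: quad_order1].
by rewrite pd_constM pd_quad halfD.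
Qed.

Lemma dx_momentum : D momentum = pairing (jet_coord A 1) lower.
Proof.
rewrite dx_order0; last first.
  by apply: vanishesM; [exact: const_order1|exact: quad_order1].
by apply: eq_bigr => s _; rewrite pd_constM pd_quad halfD.
Qed.

(** The expression whose total derivative is the right-hand side of the
    system. *)
Definition flux i : A :=
  hf i + \sum_s \sum_j C (eta i s) * jet_pd 0 s (hf j) * lower j
  - C (K / 2) * (v i * quad).

Lemma flow_flux i : eq_over U (flow eta K h i) (val (D (flux i))).
Proof.
move=> u Uu; rewrite -(dx_dfun _ Uu) /flow; apply: (Dx_eq Uo _ Uu) => {Uu}u Uu.
rewrite (dfunB _ _ Uu) (dfunD _ _ Uu) (dfunM _ _ Uu) (dfunM _ _ Uu) (constE _ _ Uu).
rewrite (quadE Uu) (dfun_coordE _ _ _ Uu) (baseE _ _ Uu) (dfun_sum _ _ _ Uu).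
congr (_ + _ - _ * _).
  apply: eq_bigr => s _; rewrite (dfun_sum _ _ _ Uu); apply: eq_bigr => j _.
  rewrite (dfunM _ _ Uu) (dfunM _ _ Uu) (constE _ _ Uu) (lowerE _ Uu).
  rewrite (pd_baseE _ _ _ _ Uu) mulr_sumr.
  by apply: eq_bigr => l _; rewrite mulrA.
rewrite mulr_sumr; apply: eq_bigr => s _; rewrite mulr_sumr.
by apply: eq_bigr => k _; ring.
Qed.

Let B := pencil_mx eta Uo h_smooth 1 0.

Lemma pencil_mx10 i j : B i j = \sum_s C (eta i s) * jet_pd 0 s (hf j).
Proof.
by rewrite /B /pencil_mx !mul0r const0 addr0 const1 mul1r.
Qed.

Lemma dx_lower j : D (lower j) = \sum_l C (theta j l) * jet_coord A 1 l.
Proof.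
rewrite dx_sum; apply: eq_bigr => l _.
by rewrite (dx_constM _ (const_vanishes Uo _)) dx_coord.
Qed.

Lemma const_sum (F : 'I_N -> R) : C (\sum_i F i) = \sum_i C (F i).
Proof. exact: (big_morph _ (constD Uo) (const0 Uo)). Qed.

Lemma const_nat (b : bool) : C b%:R = b%:R.
Proof. by case: b; rewrite ?const0 ?const1. Qed.

Lemma raise_lower (F : 'I_N -> A) s :
  \sum_j C (eta s j) * \sum_l C (theta j l) * F l = F s.
Proof.
rewrite -[RHS](sum_deltaE F s).
under eq_bigr => j _ do rewrite mulr_sumr.
rewrite exchange_big /=; apply: eq_bigr => l _.
rewrite -const_nat -eta_theta const_sum mulr_suml; apply: eq_bigr => j _.
by rewrite constM mulrA.
Qed.

(** Raising v_x after lowering it leaves the chain rule for h^i. *)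
Lemma transpose_dx i : \sum_j B j i * D (lower j) = D (hf i).
Proof.
rewrite [RHS](dx_order0 (base_vanishes Uo (h_smooth i))).
transitivity (\sum_s (\sum_j C (eta s j) * D (lower j)) * jet_pd 0 s (hf i)).
  under eq_bigr => j _ do rewrite pencil_mx10 mulr_suml.
  rewrite exchange_big /=; apply: eq_bigr => s _; rewrite mulr_suml.
  apply: eq_bigr => j _; rewrite (etaC eta_sym j s); exact: mulrAC.
apply: eq_bigr => s _; congr (_ * _).
under eq_bigr => j _ do rewrite dx_lower.
exact: raise_lower.
Qed.

(** Since w = (1/2) eta_{jl} v^j v^l, the potential W is - w. *)
Lemma ham_field_momentum i :
  ham_field B (pencil_cst K Uo 1) lower (momentum - pairing v lower) i = D (flux i).
Proof.
rewrite /ham_field transpose_dx addrC -dxD /flux -addrA; congr (D (_ + (_ + _))).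
  rewrite exchange_big /=; apply: eq_bigr => j _.
  by rewrite pencil_mx10 mulr_suml.
rewrite -[pairing v lower]/quad /momentum /pencil_cst mul1r.
have -> : C (1 / 2) * quad - quad = - (C (1 / 2) * quad).
  by rewrite -{2}[quad]halfD mulrDr; ring.
rewrite !mulrN; congr (- _).
have -> : C (K / 2) = C K * C (1 / 2) by rewrite -constM; congr C; field.
ring.
Qed.

Lemma flow_P1 i : eq_over U (flow eta K h i) (P1 Dinv eta K h (vard (H1 eta)) i).
Proof.
have xiE j : eq_over U (vard (H1 eta) j) (val (lower j)).
  by move=> u Uu; rewrite (vard_eq Uo j H1E Uu) -euler_momentum euler_dfun.
pose f (u : jet R N) := \sum_j u 1%N 0 j * vard (H1 eta) j u.
have dH : diff_fun U (H1 eta).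
  by apply: diff_fun_eq H1E _; exact: dfun_diff.
have fH : eq_over U f (Dx (H1 eta)).
  move=> u Uu; rewrite (Dx_eq Uo H1E Uu) (dx_dfun _ Uu) dx_momentum.
  rewrite (dfun_sum _ _ _ Uu); apply: eq_bigr => j _.
  by rewrite (dfunM _ _ Uu) (dfun_coordE _ _ _ Uu) (xiE j u Uu).
have [_ _ DH] := Dinv_inverse dH fH.
have DE : eq_over U (Dinv f) (val momentum).
  move=> u Uu; rewrite DH ?(H1E Uu) //; apply: dpoly0_scale.
  apply: (dpoly0_sum i) => j; apply: (dpoly0_sum i) => l.
  apply: dpoly0_mul; last exact: dpoly0_coord.
  exact/dpoly0_scale/dpoly0_coord.
have [_ /(_ i) PE] := operator_ham_field K eta_sym h_smooth 1 0 xiE DE dx_momentum.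
move=> u Uu; rewrite (flow_flux i Uu) -ham_field_momentum -(PE u Uu) /lin_comb.
by rewrite mul1r mul0r addr0.
Qed.

Definition energy : A :=
  \sum_j hf j * lower j - C (K / 8) * (quad * quad).

Lemma H2E : eq_over U (H2 eta K h) (val energy).
Proof.
move=> u Uu; rewrite (dfunB _ _ Uu) (dfunM _ _ Uu) (constE _ _ Uu) (dfunM _ _ Uu).
rewrite (quadE Uu) (dfun_sum _ _ _ Uu) /H2; congr (_ - _ * _).
  rewrite exchange_big; apply: eq_bigr => k _ /=.
  rewrite (dfunM _ _ Uu) (baseE _ _ Uu) (lowerE _ Uu) mulr_sumr.
  apply: eq_bigr => j _; rewrite (thetaC j k) mulrAC mulrC; congr (_ * _).
rewrite mulr_suml; apply: eq_bigr => j _; rewrite mulr_suml; apply: eq_bigr => k _.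
rewrite mulr_sumr; apply: eq_bigr => s _; rewrite mulr_sumr; apply: eq_bigr => l _.
ring.
Qed.

Lemma euler_energy i : euler i energy
  = \sum_j (jet_pd 0 i (hf j) * lower j + C (theta i j) * hf j)
    - C (K / 2) * (quad * lower i).
Proof.
rewrite euler_order0; last first.
  apply: vanishesD.
    apply: vanishes_sum => j; apply: vanishesM; last exact: lower_order1.
    exact: base_vanishes.
  have q1 : vanishes_from 1 (C (K / 8) * (quad * quad)).
    apply: vanishesM; first exact: const_order1.
    by apply: vanishesM; exact: quad_order1.
  by move=> k j k1; rewrite jet_pdN q1 // oppr0.
rewrite jet_pdD jet_pdN jet_pd_sum; congr (_ - _).
  apply: eq_bigr => j _; rewrite jet_pdM pd_lower thetaC; congr (_ + _).
  exact: mulrC.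
rewrite pd_constM jet_pdM pd_quad.
have c4 : C 4%:R = 4%:R by apply: const_eq => u Uu; rewrite dfun_nat.
have -> : C (K / 2) = C (K / 8) * 4%:R by rewrite -c4 -constM; congr C; field.
ring.
Qed.

(** The flux is eta^{ij} times the variational derivative of H2. *)
Lemma flux_energy i : \sum_j C (eta i j) * euler j energy = flux i.
Proof.
under eq_bigr => j _ do rewrite euler_energy mulrBr big_split mulrDr /=.
rewrite sumrB big_split /= /flux.
have -> : \sum_j C (eta i j) * (\sum_k C (theta j k) * hf k) = hf i.
  exact: raise_lower.
have -> : \sum_j C (eta i j) * (C (K / 2) * (quad * lower j))
    = C (K / 2) * (v i * quad).
  rewrite -(raise_lower v i) mulr_suml mulr_sumr; apply: eq_bigr => j _.
  rewrite -/(lower j); ring.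
rewrite [X in X - _]addrC; congr (_ + _ - _); apply: eq_bigr => s _.
by rewrite mulr_sumr; apply: eq_bigr => j _; rewrite mulrA.
Qed.

Lemma flow_P2 i : eq_over U (flow eta K h i) (P2 eta (vard (H2 eta K h)) i).
Proof.
move=> u Uu; rewrite (flow_flux i Uu) -flux_energy dx_sum (dfun_sum _ _ _ Uu).
apply: eq_bigr => j _; rewrite (dx_constM _ (const_vanishes Uo _)).
rewrite (dfunM _ _ Uu) (constE _ _ Uu); congr (_ * _).
rewrite -(dx_dfun _ Uu); apply: (Dx_eq Uo _ Uu) => w Uw.
by rewrite (vard_eq Uo j H2E Uw) (euler_dfun _ _ Uw).
Qed.

End Flow.

Theorem mainTheorem2 (R : realType) (N : nat) (U : set 'rV[R]_N)
    (eta : 'M[R]_N) (K : R) (h : 'I_N -> 'rV[R]_N -> R)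
    (Dinv : jfun R N -> jfun R N)
    (U_domain : domain U)
    (eta_sym : eta^T = eta)
    (eta_nondeg : eta \in unitmx)
    (h_smooth : forall i : 'I_N, smooth_on U (h i))
    (Dinv_inverse : formal_inverse U Dinv)
    (h_eq1 : forall (v : 'rV[R]_N) (i j k l : 'I_N), U v ->
       \sum_(s < N) \sum_(p < N)
         pd k (pd s (h i)) v * eta s p * pd p (pd l (h j)) v
       = \sum_(s < N) \sum_(p < N)
         pd k (pd s (h j)) v * eta s p * pd p (pd l (h i)) v)
    (h_eq2 : forall (v : 'rV[R]_N) (i j k : 'I_N), U v ->
       \sum_(s < N) \sum_(p < N)
         (\sum_(r < N) eta i r * pd r (h s) v
          + \sum_(r < N) eta s r * pd r (h i) v - K * v 0 i * v 0 s)
         * eta j p * pd p (pd s (h k)) v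
       = \sum_(s < N) \sum_(p < N)
         (\sum_(r < N) eta j r * pd r (h s) v
          + \sum_(r < N) eta s r * pd r (h j) v - K * v 0 j * v 0 s)
         * eta i p * pd p (pd s (h k)) v) :
  bi_hamiltonian U (flow eta K h)
    (P1 Dinv eta K h) (H1 eta) (P2 eta) (H2 eta K h).
Proof.
have [Uo _ _] := U_domain.
have comp : compatible U (P1 Dinv eta K h) (P2 eta).
  by move=> a b; exact: (pencil_hamiltonian Uo eta_sym h_smooth Dinv_inverse).
split=> //.
- have := comp 1 0; congr (hamiltonian U _).
  by apply/funext => xi; apply/funext => i; apply/funext => u;
    rewrite /lin_comb mul1r mul0r addr0.
- have := comp 0 1; congr (hamiltonian U _).
  by apply/funext => xi; apply/funext => i; apply/funext => u;
    rewrite /lin_comb mul1r mul0r add0r.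
- split.
    exact: diff_fun_eq (@H1E _ _ _ eta Uo) (dfun_diff _).
  exact: diff_fun_eq (@H2E _ _ _ _ K _ Uo eta_sym h_smooth) (dfun_diff _).
move=> i; split; first exact: flow_P1.
exact: flow_P2.
Qed.
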